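(* Let $k$ be an algebraically closed field of characteristic $p\ge 0$ and let $n\ge 2$. Let $\mathcal D$ be a codimension one distribution on $\mathbb P^n_k$. Let $Y=\mathcal Z(F)$ be a reduced hypersurface invariant by $\mathcal D$. If $Y\cap\mathrm{Sing}(\mathcal D)$ has codimension at least $3$ in $\mathbb P^n_k$, then $p>0$, $\deg F$ is a multiple of $p$ and $\mathcal D$ is given by the kernel of $dF$. In particular, $\mathcal D$ is integrable and $p$-closed.
   Context: A codimension one distribution $\mathcal D$ of degree $d$ on $\mathbb P^n_k$ is given by a saturated coherent subsheaf $T_{\mathcal D}\subset T_{\mathbb P^n_k}$ of rank $n-1$; equivalently by a nonzero $\Omega\in H^0(\mathbb P^n_k,\Omega^1_{\mathbb P^n_k}(d+2))$, unique up to a scalar, whose zero locus $\mathrm{Sing}(\mathcal D)$ has codimension $\ge 2$. In homogeneous coordinates $\Omega=\sum_{i=0}^n A_i\,dx_i$ with $A_i\in k[x_0,\dots,x_n]$ homogeneous of degree $d+1$ and $i_R\Omega=0$, $R=\sum_i x_i\partial_{x_i}$. The distribution is integrable (is a foliation) if $\Omega\wedge d\Omega=0$, equivalently $T_{\mathcal D}$ is closed under Lie bracket. When $p>0$, it is $p$-closed if $v^p\in T_{\mathcal D}$ for every local section $v\in T_{\mathcal D}$ (viewed as a derivation). Here $F$ is a square-free homogeneous polynomial defining the reduced hypersurface $Y$. $Y$ is invariant by $\mathcal D$ if $\omega\wedge\frac{df}{f}$ is a regular $2$-form for any local equation $f$ of $Y$ and local generator $\omega$ of the conormal sheaf $N^*_{\mathcal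 D}\subset\Omega^1_{\mathbb P^n_k}$. If $p$ divides $\deg F$ then $i_R dF=0$ by Euler's identity; ''$\mathcal D$ is given by the kernel of $dF$'' means that $dF\neq 0$ and $\Omega\wedge dF=0$. The empty set is regarded as having codimension larger than any integer. *)

(* Defs.v *)
From HB Require Import structures.
From mathcomp Require Import all_boot all_order all_algebra.
From mathcomp Require Import classical_sets mpoly ring.

Set Implicit Arguments.
Unset Strict Implicit.
Unset Printing Implicit Defensive.

Import GRing.Theory.
Local Open Scope quotient_scope.
Local Open Scope ring_scope.
Local Open Scope classical_set_scope.

Local Notation "x %:F" := (FracField.tofrac x).

Definition has_characteristic (k : fieldType) (p : nat) : Prop :=
  if p == 0%N then [pchar k] =i pred0 else p \in [pchar k].

(* A closed point of P^n is represented by any of its homogeneous coordinate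
   vectors, so a subset of P^n is a set of nonzero vectors; those cut out by
   homogeneous polynomials are automatically stable under scaling. *)
Definition proj_zeros (k : fieldType) (n : nat) (S : set {mpoly k[n.+1]}) :
    set ('I_n.+1 -> k) :=
  [set x | (exists i, x i != 0) /\ forall G, S G -> G.@[x] = 0].

Definition proj_closed (k : fieldType) (n : nat) (Z : set ('I_n.+1 -> k)) :
    Prop :=
  exists2 S : set {mpoly k[n.+1]},
    (forall G, S G -> exists m, G \is m.-homog) & Z = proj_zeros S.

Definition proj_irreducible_closed (k : fieldType) (n : nat)
    (Z : set ('I_n.+1 -> k)) : Prop :=
  [/\ proj_closed Z, Z !=set0 &
      forall Z1 Z2, proj_closed Z1 -> proj_closed Z2 ->
        Z `<=` Z1 `|` Z2 -> Z `<=` Z1 \/ Z `<=` Z2].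

(* C 0 < C 1 < ... < C r; the values C i with i > r are irrelevant. *)
Definition irreducible_chain (k : fieldType) (n : nat)
    (Z : set ('I_n.+1 -> k)) (r : nat) (C : nat -> set ('I_n.+1 -> k)) : Prop :=
  (forall i, (i <= r)%N -> proj_irreducible_closed (C i) /\ C i `<=` Z) /\
  (forall i, (i < r)%N -> C i `<` C i.+1).

(* Krull dimension of Z at most n - c, without truncated subtraction; the
   empty set has no chain at all, hence codimension at least every c. *)
Definition codim_ge (k : fieldType) (n c : nat) (Z : set ('I_n.+1 -> k)) :
    Prop :=
  forall (r : nat) (C : nat -> set ('I_n.+1 -> k)),
    irreducible_chain Z r C -> (c + r <= n)%N.

(* The 1-form sum_i A_i dx_i is represented by the family A of coefficients. *)
Definition sing_locus (k : fieldType) (n : nat)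
    (A : 'I_n.+1 -> {mpoly k[n.+1]}) : set ('I_n.+1 -> k) :=
  proj_zeros (range A).

Definition hypersurface (k : fieldType) (n : nat) (F : {mpoly k[n.+1]}) :
    set ('I_n.+1 -> k) :=
  proj_zeros [set F].

Record codim1_distribution (k : fieldType) (n d : nat)
    (A : 'I_n.+1 -> {mpoly k[n.+1]}) : Prop := Codim1Distribution {
  dist_homog : forall i, A i \is (d.+1).-homog;
  dist_euler : \sum_(i < n.+1) 'X_i * A i = 0;
  dist_neq0  : exists i, A i != 0;
  dist_sing  : codim_ge 2 (sing_locus A)
}.

Definition mpoly_squarefree (k : fieldType) (n : nat) (F : {mpoly k[n]}) :
    Prop :=
  forall G H : {mpoly k[n]}, F = G ^+ 2 * H -> G \is a GRing.unit.

(* Restriction to the chart U_j = {x_j <> 0} of P^n, identified with A^n by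
   x_j = 1 and x_(lift j i) = y_i for i < n. *)
Definition dehomog (k : fieldType) (n : nat) (j : 'I_n.+1)
    (P : {mpoly k[n.+1]}) : {mpoly k[n]} :=
  P \mPo [tuple (if unlift j l is Some i then 'X_i else (1 : {mpoly k[n]})) | l < n.+1].

(* Functions on the chart D(g) = {g <> 0} of A^n, in the function field of A^n:
   regular_on g h says that h lies in k[y_1, ..., y_n][1/g]. *)
Definition regular_on (k : fieldType) (n : nat) (g : {mpoly k[n]})
    (h : {fraction {mpoly k[n]}}) : Prop :=
  exists (P : {mpoly k[n]}) (m : nat),
    h = P%:F / g%:F ^+ m.

Definition unit_on (k : fieldType) (n : nat) (g : {mpoly k[n]})
    (u : {fraction {mpoly k[n]}}) : Prop :=
  [/\ u != 0, regular_on g u & regular_on g u^-1].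

(* The partial derivative d/dy_i, extended to fractions by the quotient rule
   applied to a representative; see frac_derivE. *)
Definition frac_deriv (k : fieldType) (n : nat) (i : 'I_n)
    (h : {fraction {mpoly k[n]}}) : {fraction {mpoly k[n]}} :=
  let P := \n_(repr h) in let Q := \d_(repr h) in
  (P^`M(i) * Q - P * Q^`M(i))%:F / Q%:F ^+ 2.

Lemma frac_repr (R : idomainType) (h : {fraction R}) :
  h = (\n_(repr h))%:F / (\d_(repr h))%:F.
Proof.
rewrite -[LHS]reprK; move: (repr h) => [[a b] b0] /=.
rewrite /= in b0 *; unlock FracField.tofrac.
rewrite -[X in _ = _ * X]FracField.pi_inv -[RHS]FracField.pi_mul.
rewrite /FracField.mulf /FracField.invf.
rewrite !numden_Ratio ?mul1r ?mulr1 ?oner_neq0 //.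
by congr (\pi _); rewrite -[LHS]Ratio_numden.
Qed.

Lemma frac_cross (R : idomainType) (P Q N D : R) :
  Q != 0 -> D != 0 -> P%:F / Q%:F = N%:F / D%:F -> P * D = N * Q.
Proof.
move=> Q0 D0 /eqP; rewrite eqr_div ?tofrac_eq0 // -!tofracM tofrac_eq.
by move/eqP.
Qed.

Lemma frac_uncross (R : idomainType) (P Q N D : R) :
  Q != 0 -> D != 0 -> N * Q ^+ 2 = P * D ^+ 2 ->
  N%:F / D%:F ^+ 2 = P%:F / Q%:F ^+ 2.
Proof.
move=> Q0 D0 PD; apply/eqP; rewrite eqr_div ?expf_neq0 ?tofrac_eq0 //.
by rewrite -!tofracXn -!tofracM PD.
Qed.

Lemma quotient_rule_cross (R : comNzRingType) (P Q N D dP dQ dN dD : R) :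
  P * D = N * Q -> dP * D + P * dD = dN * Q + N * dQ ->
  (dN * D - N * dD) * Q ^+ 2 = (dP * Q - P * dQ) * D ^+ 2.
Proof.
move=> PD dPD; apply/eqP; rewrite -subr_eq0.
have -> : (dN * D - N * dD) * Q ^+ 2 - (dP * Q - P * dQ) * D ^+ 2
  = (P * D - N * Q) * (Q * dD + D * dQ)
    + Q * D * (dN * Q + N * dQ - (dP * D + P * dD)) by ring.
by rewrite PD dPD !subrr mul0r mulr0 addr0.
Qed.

Lemma frac_derivE (k : fieldType) (n : nat) (i : 'I_n) (P Q : {mpoly k[n]}) :
  Q != 0 ->
  frac_deriv i (P%:F / Q%:F) =
  (P^`M(i) * Q - P * Q^`M(i))%:F / Q%:F ^+ 2.
Proof.
move=> Q0; rewrite /frac_deriv.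
move: (frac_repr (P%:F / Q%:F)) (denom_ratioP (repr (P%:F / Q%:F))).
move: (\n_ _) (\d_ _) => N D hE D0.
have PD := frac_cross Q0 D0 hE.
apply: frac_uncross => //.
have := congr1 (mderiv i) PD; rewrite !mderivM => dPD.
move: (P^`M(i)) (Q^`M(i)) (N^`M(i)) (D^`M(i)) PD dPD => dP dQ dN dD.
exact: quotient_rule_cross.
Qed.

(* The vector field sum_i v_i d/dy_i, viewed as a derivation. *)
Definition vfield_app (k : fieldType) (n : nat)
    (v : 'I_n -> {fraction {mpoly k[n]}}) (h : {fraction {mpoly k[n]}}) :
    {fraction {mpoly k[n]}} :=
  \sum_(i < n) v i * frac_deriv i h.

(* On U_j the conormal sheaf of the distribution is generated by
   Omega / x_j ^ (d+2) = sum_i dehomog j (A_(lift j i)) dy_i: the dx_j terms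
   cancel by the relation i_R Omega = 0. *)
Definition chart_form (k : fieldType) (n : nat) (j : 'I_n.+1)
    (A : 'I_n.+1 -> {mpoly k[n.+1]}) (i : 'I_n) : {fraction {mpoly k[n]}} :=
  (dehomog j (A (lift j i)))%:F.

Definition local_generator (k : fieldType) (n : nat) (j : 'I_n.+1)
    (g : {mpoly k[n]}) (A : 'I_n.+1 -> {mpoly k[n.+1]})
    (w : 'I_n -> {fraction {mpoly k[n]}}) : Prop :=
  exists2 u, unit_on g u & forall i, w i = u * chart_form j A i.

Definition local_equation (k : fieldType) (n : nat) (j : 'I_n.+1)
    (g : {mpoly k[n]}) (F : {mpoly k[n.+1]}) (f : {fraction {mpoly k[n]}}) :
    Prop :=
  exists2 u, unit_on g u & f = u * (dehomog j F)%:F.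

(* The opens D(g) of the charts U_j form a basis of the topology of P^n; the
   fractions below are the coefficients of w /\ df/f on dy_i /\ dy_l. *)
Definition invariant_by (k : fieldType) (n : nat)
    (A : 'I_n.+1 -> {mpoly k[n.+1]}) (F : {mpoly k[n.+1]}) : Prop :=
  forall (j : 'I_n.+1) (g : {mpoly k[n]}), g != 0 ->
  forall (w : 'I_n -> {fraction {mpoly k[n]}}) (f : {fraction {mpoly k[n]}}),
    local_generator j g A w -> local_equation j g F f ->
  forall i l : 'I_n,
    regular_on g ((w i * frac_deriv l f - w l * frac_deriv i f) / f).

(* dF <> 0 and Omega /\ dF = 0. *)
Definition kernel_of_differential (k : fieldType) (n : nat)
    (A : 'I_n.+1 -> {mpoly k[n.+1]}) (F : {mpoly k[n.+1]}) : Prop :=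
  (exists i, F^`M(i) != 0) /\
  (forall i l, A i * F^`M(l) - A l * F^`M(i) = 0).

(* Omega /\ dOmega = 0; the coefficient of dx_i /\ dx_l in dOmega is
   dA_l/dx_i - dA_i/dx_l. *)
Definition integrable (k : fieldType) (n : nat)
    (A : 'I_n.+1 -> {mpoly k[n.+1]}) : Prop :=
  let dA i l := (A l)^`M(i) - (A i)^`M(l) in
  forall i l m, A i * dA l m - A l * dA i m + A m * dA i l = 0.

Definition tangent_section (k : fieldType) (n : nat) (j : 'I_n.+1)
    (g : {mpoly k[n]}) (A : 'I_n.+1 -> {mpoly k[n.+1]})
    (v : 'I_n -> {fraction {mpoly k[n]}}) : Prop :=
  (forall i, regular_on g (v i)) /\ \sum_(i < n) chart_form j A i * v i = 0.

Definition p_closed (k : fieldType) (n p : nat)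
    (A : 'I_n.+1 -> {mpoly k[n.+1]}) : Prop :=
  forall (j : 'I_n.+1) (g : {mpoly k[n]}), g != 0 ->
  forall v : 'I_n -> {fraction {mpoly k[n]}}, tangent_section j g A v ->
  exists2 w : 'I_n -> {fraction {mpoly k[n]}}, tangent_section j g A w &
    forall h, vfield_app w h = iter p (vfield_app v) h.

(* Main.v *)
Require Import Defs.
From mathcomp Require Import all_boot all_order all_algebra.
From mathcomp Require Import boolp classical_sets mpoly ring.

(* Write F_i for dF/dx_i. Invariance of Y means that F divides all the
   A_i F_l - A_l F_i, so on the cone R = k[x_0, ..., x_n] / (F) the vectors
   (F_i) and (A_i) are proportional. As Y meets Sing(D) in codimension at least
   3, the ideal (F, A_0, ..., A_n) contains a regular sequence F, s, t; hence
   the ratio F_i / A_i, which has both s and t as denominators on R, is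
   regular: F_i = G A_i mod F. The degree of F_i being less than that of F,
   this is an equality F_i = G A_i for some form G, i.e. dF = G Omega. Euler's
   identity gives (deg F) F = G i_R Omega = 0, so deg F = 0 in k, whence p > 0
   and p | deg F. If dF were zero, F would be a p-th power, against
   square-freeness; so dF defines D, and a derivation killing F has all its
   iterates killing F.

   The regular sequence comes from cutting Y /\ Sing(D) by n - 2 hyperplanes
   through a point z outside Y: each cut lowers the dimension, so some plane
   through z misses Y /\ Sing(D). If that plane is spanned by the last three
   coordinate vectors, the last one being z, then F is monic in x_n, and
   elimination by resultants yields s, monic in x_(n-1), in the ideal and free
   of x_n, then t, nonzero and free of both x_n and x_(n-1). *)

Set Implicit Arguments.
Unset Strict Implicit.
Unset Printing Implicit Defensive.

Import GRing.Theory Order.Theory.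
Local Open Scope ring_scope.

Local Notation "x %:F" := (FracField.tofrac x).

(** * Polynomials in n + 1 variables as polynomials in the last one *)

Section MpolyGeneralities.
Variable n : nat.

(** Suited to identities between ring morphisms, which need checking only on constants and
    variables. *)
Lemma mpoly_ring_ind (R : nzRingType) (P : {mpoly R[n]} -> Prop) :
  (forall c, P c%:MP) -> (forall i, P 'X_i) ->
  (forall p q, P p -> P q -> P (p + q)) ->
  (forall p q, P p -> P q -> P (p * q)) ->
  forall p, P p.
Proof.
move=> PC PX PD PM; elim/mpolyind => [|c m p _ _ Pp].
  by rewrite -mpolyC0; apply: PC.
apply: (PD) => //; rewrite -mul_mpolyC; apply: (PM) => //.
rewrite mpolyXE_id; elim/big_rec: _ => [|i q _ Pq].
  by rewrite -mpolyC1; apply: PC.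
apply: (PM) => //; elim: (m i) => [|l IHl]; first by rewrite expr0 -mpolyC1.
by rewrite exprS; apply: PM.
Qed.

(** Stated for [mmap] to cover both evaluation at a multiple of a point and the substitution of
    [x_j * (x_i / x_j)] for [x_i]. *)
Lemma mmap_dhomog_scale (R : nzRingType) (S : comNzRingType)
    (f : {rmorphism R -> S}) (h h' : 'I_n -> S) (c : S) e (F : {mpoly R[n]}) :
  F \is e.-homog -> (forall i, h' i = c * h i) ->
  mmap f h' F = c ^+ e * mmap f h F.
Proof.
move=> /dhomogP homF h'E; rewrite /mmap big_distrr /=.
rewrite big_seq [RHS]big_seq; apply: eq_bigr => m /homF mE.
rewrite mulrCA; congr (_ * _); rewrite /mmap1.
under eq_bigr => i _ do rewrite h'E exprMn.
rewrite big_split /=; congr (_ * _).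
by rewrite prodrXr -mdegE mE.
Qed.

Lemma dhomog_meval_scale (R : comNzRingType) (x : 'I_n -> R) (c : R) e
    (F : {mpoly R[n]}) :
  F \is e.-homog -> F.@[fun i => c * x i] = c ^+ e * F.@[x].
Proof. by move=> homF; apply: mmap_dhomog_scale. Qed.

Lemma mpoly_euler (R : comNzRingType) e (F : {mpoly R[n]}) :
  F \is e.-homog -> \sum_(i < n) 'X_i * F^`M(i) = F *+ e.
Proof.
move=> /dhomogP homF; rewrite [F in RHS]mpolyE -sumrMnl.
under eq_bigr => i _ do rewrite /mderiv big_distrr /=.
rewrite exchange_big /= big_seq [RHS]big_seq; apply: eq_bigr => m /homF <-.
rewrite /= mdegE -sumrMnr; apply: eq_bigr => i _.
rewrite -scalerAr -mpolyXD -scalerA scaler_nat.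
(* Subtraction of exponents truncates when [m i = 0], but then the coefficient is 0. *)
have [->|mi0] := eqVneq (m i) 0%N; first by rewrite !mulr0n.
by rewrite addmC submK ?lep1mP.
Qed.

Lemma pihomogM (R : comNzRingType) d e (p q : {mpoly R[n]}) :
  q \is e.-homog -> pihomog mdeg (d + e) (p * q) = pihomog mdeg d p * q.
Proof.
move=> homq; elim/mpolyind: p => [|c m p _ _ IHp]; first by rewrite !(mul0r, raddf0).
rewrite mulrDl !raddfD mulrDl /= IHp; congr (_ + _).
rewrite -scalerAl !linearZ -scalerAl /= pihomogX; congr (_ *: _).
have homXq : 'X_[m] * q \is (mdeg m + e).-homog by apply: dhomogM; rewrite ?dhomogX.
case: eqP => [dE|dE]; first by rewrite pihomog_dE // -dE.
rewrite mul0r; apply: pihomog_ne0 homXq.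
by rewrite eqn_add2r; apply/eqP.
Qed.

Lemma pihomogM_lt (R : comNzRingType) d e (p q : {mpoly R[n]}) :
  q \is e.-homog -> (d < e)%N -> pihomog mdeg d (p * q) = 0.
Proof.
move=> homq de; elim/mpolyind: p => [|c m p _ _ IHp]; first by rewrite !(mul0r, raddf0).
rewrite mulrDl !raddfD /= IHp addr0 -scalerAl linearZ /=.
have homXq : 'X_[m] * q \is (mdeg m + e).-homog by apply: dhomogM; rewrite ?dhomogX.
rewrite (pihomog_ne0 _ homXq) ?scaler0 // gtn_eqF //.
exact: leq_trans de (leq_addl _ _).
Qed.

Lemma dhomog_comp_linear (R : comNzRingType) n' (lp : n.-tuple {mpoly R[n']}) e
    (F : {mpoly R[n]}) :
  (forall i, tnth lp i \is 1.-homog) -> F \is e.-homog -> F \mPo lp \is e.-homog.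
Proof.
move=> homlp /dhomogP homF; rewrite comp_mpolyE big_seq rpred_sum // => m mF.
rewrite rpredZ //.
have -> : e = (\sum_i 1 * m i)%N.
  by rewrite -(homF _ mF) /= mdegE; apply: eq_bigr => i _; rewrite mul1n.
elim/big_ind2: _ => [|? ? ? ? ? ?|i _]; first exact: dhomog1.
  exact: dhomogM.
by apply: dhomogMn; apply: homlp.
Qed.
End MpolyGeneralities.

Section ExtendPoint.
Variables (T : Type) (n : nat).

(** The new coordinate comes last because [muni] singles out the last variable. *)
Definition extend_point (y : 'I_n -> T) (t : T) (i : 'I_n.+1) : T :=
  if unlift ord_max i is Some j then y j else t.

Lemma extend_point_max y t : extend_point y t ord_max = t.
Proof. by rewrite /extend_point unlift_none. Qed.

Lemma extend_point_widen y t j : extend_point y t (widen_ord (leqnSn n) j) = y j.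
Proof.
rewrite /extend_point.
have -> : widen_ord (leqnSn n) j = lift ord_max j.
  by apply: val_inj; rewrite /= /bump leqNgt ltn_ord.
by rewrite liftK.
Qed.

End ExtendPoint.

Section Muni.
Variables (n : nat) (R : comNzRingType).

Lemma ord_max_cases (i : 'I_n.+1) :
  i = ord_max \/ exists j : 'I_n, i = widen_ord (leqnSn n) j.
Proof.
case: (unliftP ord_max i) => [j ->|->]; last by left.
by right; exists j; apply: val_inj; rewrite /= /bump leqNgt ltn_ord.
Qed.

Lemma muniX_max : muni ('X_ord_max : {mpoly R[n.+1]}) = 'X.
Proof.
rewrite muniE msuppX big_seq1 mcoeffX eqxx scale1r mnm1E eqxx expr1.
rewrite -[RHS]scale1r -mpolyX0; congr (_ *: _); congr ('X_[_]).
by apply/mnmP => i; rewrite mnmE mnm1E mnm0E; case: eqP => // /(congr1 val) /= E;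
  have := ltn_ord i; rewrite -E ltnn.
Qed.

Lemma muniX_widen (i : 'I_n) :
  muni ('X_(widen_ord (leqnSn n) i) : {mpoly R[n.+1]}) = ('X_i)%:P.
Proof.
rewrite muniE msuppX big_seq1 mcoeffX eqxx scale1r mnm1E.
case: eqP => [/(congr1 val) /= E|_]; first by have := ltn_ord i; rewrite E ltnn.
rewrite expr0 alg_polyC; congr (_ %:P); congr ('X_[_]).
by apply/mnmP => j; rewrite mnmE !mnm1E -!val_eqE.
Qed.

Lemma mwidenXU (i : 'I_n) :
  mwiden ('X_i : {mpoly R[n]}) = 'X_(widen_ord (leqnSn n) i).
Proof. by rewrite mwidenX mnmwiden1. Qed.

Lemma muni_mwiden (p : {mpoly R[n]}) : muni (mwiden p) = p%:P.
Proof.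
elim/mpoly_ring_ind: p => [c|i|p q IHp IHq|p q IHp IHq].
- by rewrite mwidenC muniC.
- by rewrite mwidenXU muniX_widen.
- by rewrite mwidenD muniD polyCD IHp IHq.
by rewrite mwidenM muniM polyCM IHp IHq.
Qed.

(** Inverts [muni], to bring univariate divisions and resultants back to [{mpoly R[n.+1]}]. *)
Definition ofuni (P : {poly {mpoly R[n]}}) : {mpoly R[n.+1]} :=
  (map_poly (@mwiden n R) P).['X_ord_max].

Lemma ofuniD P Q : ofuni (P + Q) = ofuni P + ofuni Q.
Proof. by rewrite /ofuni (rmorphD (map_poly (@mwiden n R))) hornerD. Qed.

Lemma ofuniM P Q : ofuni (P * Q) = ofuni P * ofuni Q.
Proof. by rewrite /ofuni (rmorphM (map_poly (@mwiden n R))) hornerM. Qed.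

Lemma ofuniC p : ofuni p%:P = mwiden p.
Proof. by rewrite /ofuni map_polyC hornerC. Qed.

Lemma ofuniX : ofuni 'X = 'X_ord_max.
Proof. by rewrite /ofuni map_polyX hornerX. Qed.

Lemma muniK (p : {mpoly R[n.+1]}) : ofuni (muni p) = p.
Proof.
elim/mpoly_ring_ind: p => [c|i|p q IHp IHq|p q IHp IHq].
- by rewrite muniC ofuniC mwidenC.
- have [->|[j ->]] := ord_max_cases i; first by rewrite muniX_max ofuniX.
  by rewrite muniX_widen ofuniC mwidenXU.
- by rewrite muniD ofuniD; congr (_ + _).
by rewrite muniM ofuniM; congr (_ * _).
Qed.

Lemma meval_muni (y : 'I_n -> R) (t : R) (p : {mpoly R[n.+1]}) :
  (map_poly (meval y) (muni p)).[t] = p.@[extend_point y t].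
Proof.
elim/mpoly_ring_ind: p => [c|i|p q IHp IHq|p q IHp IHq].
- by rewrite muniC map_polyC hornerC /= !mevalC.
- have [->|[j ->]] := ord_max_cases i.
    by rewrite muniX_max map_polyX hornerX mevalXU extend_point_max.
  by rewrite muniX_widen map_polyC hornerC /= !mevalXU extend_point_widen.
- by rewrite muniD (rmorphD (map_poly (meval y))) hornerD mevalD; congr (_ + _).
by rewrite muniM (rmorphM (map_poly (meval y))) hornerM mevalM; congr (_ * _).
Qed.

Lemma pihomog_mwiden d (p : {mpoly R[n]}) :
  pihomog mdeg d (mwiden p) = mwiden (pihomog mdeg d p).
Proof.
elim/mpolyind: p => [|c m p _ _ IHp]; first by rewrite !raddf0.
rewrite !raddfD /= IHp; congr (_ + _).
rewrite mwidenZ mwidenX !linearZ /= mwidenZ !pihomogX.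
suff E : mdeg (mnmwiden m) = mdeg m by rewrite /= E; case: ifP; rewrite ?mwidenX ?mwiden0.
rewrite !mdegE big_ord_recr /= mnmwiden_ordmax addn0.
by apply: eq_bigr => i _; rewrite mnmwiden_widen.
Qed.

End Muni.

Lemma closed_field_avoid (k : closedFieldType) (s : seq k) : exists x, x \notin s.
Proof.
have : \prod_(a <- s) ('X - a%:P) != 0 by rewrite monic_neq0 ?monic_prod_XsubC.
by case/closed_nonrootP => x; rewrite root_prod_XsubC; exists x.
Qed.

(** Induction on [n]: the first coordinates avoid the zeros of the leading coefficient in the last
    variable, and the last coordinate avoids finitely many roots. *)
Lemma mpoly_nonvanishing (k : closedFieldType) n (F : {mpoly k[n]}) :
  F != 0 -> exists z, F.@[z] != 0.
Proof.
elim: n F => [|n IHn] F F0.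
  exists (fun=> 0); rewrite -(mpolyKC F) mevalC; apply: contra F0 => /eqP E.
  by rewrite -(mpolyKC F) E mpolyC0.
have : lead_coef (muni F) != 0.
  by rewrite lead_coef_eq0; apply: contra F0 => /eqP E; rewrite -(muniK F) E /ofuni map_poly0 horner0.
case/IHn => y y0.
have evF0 : map_poly (meval y) (muni F) != 0.
  by rewrite -size_poly_eq0 size_map_poly_id0 // size_poly_eq0 -lead_coef_eq0;
    apply: contra y0 => /eqP ->; rewrite meval0.
have /closed_nonrootP[t] := evF0; rewrite /root meval_muni => Ft.
by exists (extend_point y t).
Qed.

(** * Elimination *)

Record ideal (R : comNzRingType) (J : R -> Prop) : Prop := Ideal {
  idealD : forall p q, J p -> J q -> J (p + q);
  idealM : forall p q, J q -> J (p * q)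
}.

Section Elimination.
Variables (S : comNzRingType) (k : closedFieldType).
Variables (ev : {rmorphism S -> k}) (iota : {rmorphism k -> S}).
Hypothesis iotaK : cancel iota ev.
Variable J : {poly S} -> Prop.
Hypothesis idJ : ideal J.

Local Notation "p ^ev" := (map_poly ev p) (at level 2, format "p ^ev").

(** Both degrees are preserved by [ev], so the Sylvester matrix keeps its format and specializes
    entry by entry. *)
Lemma map_resultant_lead (p q : {poly S}) :
  ev (lead_coef p) != 0 -> ev (lead_coef q) != 0 ->
  ev (resultant p q) = resultant p^ev q^ev.
Proof.
move=> nz_p nz_q; rewrite /resultant /Sylvester_mx !size_map_poly_id0 //.
rewrite -det_map_mx /= map_col_mx; congr (\det (col_mx _ _));
  by apply: map_lin1_mx => v; rewrite map_poly_rV rmorphM /= map_rVpoly.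
Qed.

(** The specializations of the elements of [J] have no common root, so they contain a nonzero
    constant. Euclid's algorithm finds it: a root of [f^ev] is missed by some [g^ev], whose
    remainder by [f^ev] is nonzero and smaller. *)
Lemma ideal_specialize_unit (f : {poly S}) :
  J f -> f^ev != 0 ->
  (forall t, exists2 g, J g & g^ev.[t] != 0) ->
  exists2 g, J g & size g^ev = 1%N.
Proof.
move=> Jf f0 noroot; have [m] := ubnP (size f^ev).
elim: m f Jf f0 => // m IHm f Jf f0 lefm.
have [szf|/closed_rootP[t ft]] := eqVneq (size f^ev) 1%N; first by exists f.
have [g Jg gt] := noroot t.
(* An element of [J] lifting the remainder; the quotient is lifted through [iota]. *)
pose h := g - map_poly iota (g^ev %/ f^ev) * f.
have hE : h^ev = g^ev %% f^ev.
  rewrite rmorphB rmorphM /= -map_poly_comp.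
  rewrite [X in _ - X * _](_ : _ = g^ev %/ f^ev).
    by rewrite [X in X - _ = _](divp_eq g^ev f^ev) addrC addKr.
  by apply: map_poly_id => x _; apply: iotaK.
apply: (IHm h).
- by rewrite /h -mulNr; apply: (idealD idJ) => //; apply: (idealM idJ).
- apply: contra gt; rewrite hE => /eqP E; rewrite (divp_eq g^ev f^ev) E addr0.
  by rewrite hornerM (rootP ft) mulr0.
by move: lefm; rewrite ltnS hE; apply: leq_trans; rewrite ltn_modp.
Qed.

(** The resultant of [f] with an element of [J] that specializes to a polynomial prime to [f^ev]
    lies in [J], is free of the variable and does not vanish under [ev]. *)
Lemma elimination (f : {poly S}) :
  J f -> ev (lead_coef f) != 0 ->
  (forall t, exists2 g, J g & g^ev.[t] != 0) ->
  exists2 s, J s%:P & ev s != 0.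
Proof.
move=> Jf evf noroot.
have szf : size f^ev = size f by rewrite size_map_poly_id0.
have f0 : f^ev != 0.
  rewrite -size_poly_eq0 szf size_poly_eq0 -lead_coef_eq0.
  by apply: contra evf => /eqP ->; rewrite rmorph0.
have fn0 : (0 < size f)%N by rewrite -szf size_poly_gt0.
(* A constant [f] is its own witness; the resultant requires positive degrees. *)
have [szf1|szf1] := leqP (size f) 1%N.
  have fE := size1_polyC szf1; exists f`_0; first by rewrite -fE.
  by move: evf; rewrite lead_coefE (_ : (size f).-1 = 0%N) //; case: (size f) szf1 => [|[]].
have [g Jg szg] := ideal_specialize_unit Jf f0 noroot.
(* The leading coefficient of [g] may vanish under [ev]. Adding a multiple of [f] of larger degree
   gives [h] the leading coefficient of [f]. *)
pose M := (size g).+1; pose h := g + f * 'X^M.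
have fXM : size (f * 'X^M) = (M + size f)%N.
  by rewrite size_mulXn // -size_poly_gt0.
have ltg : (size g < size (f * 'X^M)%R)%N by rewrite fXM; exact: leq_addr.
have lch : lead_coef h = lead_coef f.
  by rewrite /h addrC lead_coefDl // lead_coef_Mmonic ?monicXn.
have szh : (1 < size h)%N.
  by rewrite /h addrC size_polyDl // fXM; case: (size f) szf1 => // ? _; rewrite addnS ltnS.
have Jh : J h by apply: (idealD idJ) => //; rewrite mulrC; apply: (idealM idJ).
have [[u v] _ /= E] := resultant_in_ideal szf1 szh.
exists (resultant f h); first by rewrite E; apply: (idealD idJ); apply: (idealM idJ).
rewrite map_resultant_lead ?lch // resultant_eq0 -leqNgt.
suff /eqP -> : size (gcdp f^ev h^ev) == 1%N by [].
(* Bezout relation: [h^ev - 'X^M * f^ev] is [g^ev], a nonzero constant. *)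
rewrite -/(coprimep _ _); apply/Bezout_coprimepP; exists (- 'X^M, 1) => /=.
rewrite /h rmorphD rmorphM /= map_polyXn mul1r mulNr mulrC addrC addrK.
by rewrite -size_poly_eq1 szg.
Qed.
End Elimination.

(** * Elimination for homogeneous ideals *)

Section MuniHomog.
Variables (n : nat) (R : comNzRingType).

Lemma mdeg_widen (m : 'X_{1..n.+1}) :
  mdeg m = (\sum_(i < n) m (widen_ord (leqnSn n) i) + m ord_max)%N.
Proof. by rewrite mdegE big_ord_recr. Qed.

Lemma size_muni_homog e (F : {mpoly R[n.+1]}) :
  F \is e.-homog -> (size (muni F) <= e.+1)%N.
Proof.
move=> /dhomogP homF; rewrite muniE big_seq.
apply: (big_ind (fun p : {poly _} => size p <= e.+1)%N) => [|p q szp szq|m /homF mE].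
- by rewrite size_poly0.
- by rewrite (leq_trans (size_polyD _ _)) // geq_max szp.
rewrite (leq_trans (size_scale_leq _ _)) // size_polyXn ltnS -mE /= mdeg_widen.
exact: leq_addl.
Qed.

Definition last_point : 'I_n.+1 -> R := extend_point (fun=> 0) 1.

(** Only the [e]-th power of the last variable contributes on either side: any other monomial of
    degree [e] involves a variable that vanishes at [last_point]. *)
Lemma coef_muni_homog e (F : {mpoly R[n.+1]}) :
  F \is e.-homog -> (muni F)`_e = (F.@[last_point])%:MP.
Proof.
move=> /dhomogP homF; rewrite muniE coef_sum mevalE raddf_sum /=.
rewrite big_seq [RHS]big_seq; apply: eq_bigr => m /homF /= mE.
rewrite coefZ coefXn big_ord_recr /= /last_point extend_point_max expr1n mulr1.
under [X in _ = (_ * X)%:MP]eq_bigr => i _ do rewrite extend_point_widen.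
rewrite mpolyCM -mul_mpolyC -mulrA; congr (_ * _).
have [eE|eE] := eqVneq e (m ord_max).
  have m0 : forall i : 'I_n, m (widen_ord (leqnSn n) i) = 0%N.
    move: mE; rewrite mdeg_widen eE -[RHS]add0n => /addIn/eqP.
    by rewrite sum_nat_eq0 => /forallP m0 i; apply/eqP/m0.
  rewrite mulr1 big1 => [|i _]; last by rewrite m0 expr0.
  rewrite mpolyC1 -mpolyX0; congr ('X_[_]); apply/mnmP => i.
  by rewrite mnmE mnm0E m0.
rewrite mulr0; apply/esym; have [i mi] : exists i : 'I_n, m (widen_ord (leqnSn n) i) != 0%N.
  apply/existsP; apply: contraR eE => /existsPn m0.
  rewrite -mE mdeg_widen big1 ?add0n // => i _.
  by have := m0 i; rewrite negbK => /eqP.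
by rewrite (bigD1 i) //= expr0n (negbTE mi) mul0r mpolyC0.
Qed.

End MuniHomog.

Record homog_ideal (R : comNzRingType) n (J : {mpoly R[n]} -> Prop) : Prop := HomogIdeal {
  homog_ideal_ideal : ideal J;
  homog_idealP : forall d p, J p -> J (pihomog mdeg d p)
}.

(** The elimination ideal is again homogeneous, which allows a second elimination. *)
Lemma homog_ideal_section (R : comNzRingType) n (J : {mpoly R[n.+1]} -> Prop) :
  homog_ideal J -> homog_ideal (fun s : {mpoly R[n]} => J (mwiden s)).
Proof.
move=> [idJ homJ]; split; first split=> p q.
- by rewrite mwidenD; apply: idealD.
- by rewrite mwidenM; apply: idealM.
by move=> d p Jp; rewrite -pihomog_mwiden; apply: homJ.
Qed.

Lemma pihomog_meval_neq0 (R : comNzRingType) n (p : {mpoly R[n]}) y :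
  p.@[y] != 0 -> exists d, (pihomog mdeg d p).@[y] != 0.
Proof.
rewrite {1}(pihomog_partitionE (leqnn (mmeasure mdeg p))) raddf_sum /=.
case: (pselect (exists d, (pihomog mdeg d p).@[y] != 0)) => // nex.
rewrite big1 ?eqxx // => d _; apply/eqP; apply/negP => /negP dy.
by apply: nex; exists d.
Qed.

Section LastMonic.
Variables (k : fieldType) (n e : nat) (F : {mpoly k[n.+1]}).
Hypotheses (homF : F \is e.-homog) (F0 : F.@[@last_point n k] != 0).

Lemma lead_coef_muni : lead_coef (muni F) = (F.@[@last_point n k])%:MP.
Proof.
rewrite -(coef_muni_homog homF) lead_coefE.
suff -> : size (muni F) = e.+1 by [].
apply/eqP; rewrite eqn_leq (size_muni_homog homF) ltnNge; apply/negP => szF.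
have /eqP := coef_muni_homog homF.
by rewrite nth_default // eq_sym mpolyC_eq0 (negbTE F0).
Qed.

Lemma muni_monic : muni ((F.@[@last_point n k])^-1 *: F) \is monic.
Proof.
rewrite muniZ monicE lead_coefZ lead_coef_muni -mpolyCM mulVf //.
Qed.
End LastMonic.

(** Projection from [last_point]: since [F] has a nonzero constant as leading coefficient in the
    last variable, [elimination] applies over every [y]. *)
Lemma homog_elimination (k : closedFieldType) n (J : {mpoly k[n.+1]} -> Prop) e
    (F : {mpoly k[n.+1]}) (y : 'I_n -> k) :
  homog_ideal J -> J F -> F \is e.-homog -> F.@[@last_point n k] != 0 ->
  (forall t, exists2 g, J g & g.@[extend_point y t] != 0) ->
  exists d, exists s : {mpoly k[n]}, [/\ s \is d.-homog, J (mwiden s) & s.@[y] != 0].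
Proof.
move=> homJ JF homF F0 noroot.
have [idJ _] := homJ.
pose J' (P : {poly {mpoly k[n]}}) := J (ofuni P).
have idJ' : ideal J'.
  split=> p q; rewrite /J' ?ofuniD ?ofuniM; [exact: idealD|exact: idealM].
have iotaK : cancel (@mpolyC n k) (meval y) by move=> c; rewrite mevalC.
have [||t|s Js sy] := elimination (ev := meval y) iotaK idJ' (f := muni F).
- by rewrite /J' muniK.
- by rewrite (lead_coef_muni homF F0) /= mevalC.
- have [g Jg gt] := noroot t.
  by exists (muni g); [rewrite /J' muniK | rewrite meval_muni].
(* The eliminant need not be homogeneous; one of its components is nonzero at [y] and stays in the
   ideal. *)
have [d sdy] := pihomog_meval_neq0 sy.
exists d, (pihomog mdeg d s); split=> //; first exact: pihomogP.
by apply: (homog_idealP (homog_ideal_section homJ)); move: Js; rewrite /J' ofuniC.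
Qed.

Definition plane_point (k : fieldType) m (a b c : k) : 'I_m.+3 -> k :=
  extend_point (extend_point (extend_point (fun=> 0) a) b) c.

Lemma extend_point0 (k : fieldType) m : extend_point (fun=> 0) (0 : k) = (fun=> 0) :> ('I_m.+1 -> k).
Proof. by apply: funext => i; rewrite /extend_point; case: unlift. Qed.

Lemma homog_elimination2 (k : closedFieldType) m (J : {mpoly k[m.+3]} -> Prop) e
    (F : {mpoly k[m.+3]}) :
  homog_ideal J -> J F -> F \is e.-homog -> F.@[@last_point m.+2 k] != 0 ->
  (forall a b c : k, (a, b, c) != 0 -> exists2 g, J g & g.@[@plane_point k m a b c] != 0) ->
  exists d (s : {mpoly k[m.+2]}) (t : {mpoly k[m.+1]}),
    [/\ s \is d.-homog, s.@[@last_point m.+1 k] != 0, t != 0,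
        J (mwiden s) & J (mwiden (mwiden t))].
Proof.
move=> homJ JF homF F0 nozero.
have elimF y := homog_elimination (y := y) homJ JF homF F0.
(* The points over [last_point] are the [plane_point 0 1 c]. *)
have [c|d [s [homs Js s0]]] := elimF (@last_point m.+1 k).
  have [|g Jg g0] := nozero 0 1 c; last by exists g; rewrite // /last_point -extend_point0.
  by rewrite !xpair_eqE oner_eq0 andbF.
have homJS := homog_ideal_section homJ.
(* Second elimination, in the elimination ideal and with [s] in the role of [F]. Over [(1, b)] the
   first elimination provides a form nonzero there, as no [plane_point 1 b c] is a common zero. *)
have [b|d' [t [_ Jt t0]]] := homog_elimination (y := last_point k : 'I_m.+1 -> k) homJS Js homs s0.
  have [c|d' [s' [_ Js' s'0]]] := elimF (extend_point (last_point k : 'I_m.+1 -> k) b); last by exists s'.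
  have [|g Jg g0] := nozero 1 b c; last by exists g.
  by rewrite !xpair_eqE oner_eq0.
exists d, s, t; split=> //.
by apply: contra t0 => /eqP ->; rewrite meval0.
Qed.

(** * Division on a hypersurface *)

Section Regularity.
Import Pdiv.Ring Pdiv.RingMonic.
Variable S : idomainType.

(** Remainders modulo a monic [F] form a free [S]-module, on which [s] acts coefficientwise, hence
    injectively. *)
Lemma monic_regular (F : {poly S}) (s : S) (x q : {poly S}) :
  F \is monic -> s != 0 -> s%:P * x = q * F -> exists q', x = q' * F.
Proof.
move=> monF s0 E; exists (rdivp x F).
rewrite [LHS](rdivp_eq monF); suff -> : rmodp x F = 0 by rewrite addr0.
have : s *: rmodp x F = 0 by rewrite -rmodpZ // -mul_polyC E rmodp_mull.
by move/eqP; rewrite -mul_polyC mulf_eq0 polyC_eq0 (negbTE s0) => /eqP.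
Qed.

(** The regularity of [t] modulo [s] passes from [S] to the free module of remainders, coefficient
    by coefficient. *)
Lemma monic_regular2 (F : {poly S}) (s t : S) (x y q : {poly S}) :
  F \is monic -> (forall a b, t * a = s * b -> exists c, a = s * c) ->
  t%:P * x = s%:P * y + q * F -> exists G q', x = s%:P * G + q' * F.
Proof.
move=> monF reg E.
have Er : t *: rmodp x F = s *: rmodp y F.
  by rewrite -!rmodpZ // -!mul_polyC E rmodpD // rmodp_mull // addr0.
have [c cE] : exists c : nat -> S, forall i, (rmodp x F)`_i = s * c i.
  suff /choice[c cE] : forall i, exists c, (rmodp x F)`_i = s * c by exists c.
  by move=> i; apply: (reg _ (rmodp y F)`_i); rewrite -!coefZ Er.
exists (\poly_(i < size (rmodp x F)) c i), (rdivp x F).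
rewrite [LHS](rdivp_eq monF) addrC; congr (_ + _).
apply/polyP => i; rewrite coefCM coef_poly cE.
by case: ltnP => // szi; rewrite mulr0 -cE nth_default.
Qed.
End Regularity.

Section RatioDivision.
Variables (R : comNzRingType) (I : finType) (F s t : R) (A B : I -> R).

Definition congr_mod x y := exists q, x = y + q * F.

Lemma congr_mod_trans y x z : congr_mod x y -> congr_mod y z -> congr_mod x z.
Proof. by move=> [q ->] [q' ->]; exists (q' + q); rewrite mulrDl addrA. Qed.

Lemma congr_mod_sym x y : congr_mod x y -> congr_mod y x.
Proof. by move=> [q ->]; exists (- q); rewrite mulNr addrK. Qed.

Lemma congr_mod_refl x : congr_mod x x.
Proof. by exists 0; rewrite mul0r addr0. Qed.

Lemma congr_modMl z x y : congr_mod x y -> congr_mod (z * x) (z * y).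
Proof. by move=> [q ->]; exists (z * q); rewrite mulrDr mulrA. Qed.

Lemma congr_modMr z x y : congr_mod x y -> congr_mod (x * z) (y * z).
Proof. by move=> h; rewrite -!(mulrC z); apply: congr_modMl. Qed.

Lemma congr_mod_sum (x y : I -> R) :
  (forall i, congr_mod (x i) (y i)) -> congr_mod (\sum_i x i) (\sum_i y i).
Proof.
move=> h; elim/big_ind2: _ => // [|x1 x2 y1 y2 [q ->] [q' ->]]; first exact: congr_mod_refl.
by exists (q + q'); rewrite mulrDl addrACA.
Qed.

(* If F, s, t is a regular sequence with s and t in the ideal (F, A), then on
   R/F the ratio B/A has the denominators s and t, hence none. *)
Lemma ratio_division (cs ct : I -> R) :
  (forall i l, congr_mod (A i * B l) (A l * B i)) ->
  congr_mod s (\sum_i cs i * A i) -> congr_mod t (\sum_i ct i * A i) ->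
  (forall x q, s * x = q * F -> exists q', x = q' * F) ->
  (forall x y q, t * x = s * y + q * F -> exists G q', x = s * G + q' * F) ->
  exists G, forall i, congr_mod (B i) (G * A i).
Proof.
move=> AB sE tE reg1 reg2.
(* For [u] in the ideal, [u] times the ratio [B i / A i] is a combination of the [B j] that does not
   depend on [i]. *)
have comb u cu i : congr_mod u (\sum_j cu j * A j) ->
    congr_mod (u * B i) (A i * \sum_j cu j * B j).
  move=> uE; apply: (congr_mod_trans (congr_modMr _ uE)).
  rewrite big_distrl big_distrr /=; apply: congr_mod_sum => j.
  by rewrite -mulrA [A i * _]mulrCA; apply: congr_modMl.
have [q Eq] : congr_mod (t * \sum_i cs i * B i) (s * \sum_i ct i * B i).
  apply: (@congr_mod_trans (\sum_i cs i * (A i * \sum_j ct j * B j))).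
    rewrite big_distrr /=; apply: congr_mod_sum => i.
    by rewrite mulrCA; apply/congr_modMl/comb.
  under eq_bigr => i _ do rewrite mulrA.
  by rewrite -big_distrl /=; apply/congr_mod_sym/congr_modMr.
(* By regularity of [t] modulo [F] and [s], the numerator over [s] is a multiple of [s]; the
   quotient [G] is the ratio. *)
have [G [q' EG]] := reg2 _ _ _ Eq; exists G => i.
have [q'' Ei] : congr_mod (s * B i) (s * (G * A i)).
  apply: (congr_mod_trans (comb _ _ i sE)); exists (A i * q').
  by rewrite EG; ring.
have [r rE] : exists r, B i - G * A i = r * F.
  by apply: (reg1 _ q''); rewrite mulrBr Ei addrAC subrr add0r.
by exists r; rewrite -rE addrC subrK.
Qed.
End RatioDivision.

(** * Division of forms modulo a form *)

Lemma pihomog_mulr (R : comNzRingType) n d e (p q : {mpoly R[n]}) :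
  q \is e.-homog ->
  exists2 r, pihomog mdeg d (p * q) = r * q & r \is (d - e).-homog.
Proof.
move=> homq; case: (leqP e d) => [ed|de].
  exists (pihomog mdeg (d - e) p); last exact: pihomogP.
  by rewrite -(pihomogM _ _ homq) subnK.
by exists 0; rewrite ?rpred0 // mul0r (pihomogM_lt _ homq).
Qed.

Lemma muni_monic_regular (k : fieldType) n (F : {mpoly k[n.+1]}) (s : {mpoly k[n]})
    (x q : {mpoly k[n.+1]}) :
  muni F \is monic -> s != 0 -> mwiden s * x = q * F -> exists q', x = q' * F.
Proof.
move=> monF s0 /(congr1 (@muni _ _)); rewrite !muniM muni_mwiden.
case/(monic_regular monF s0) => q' Eq'; exists (ofuni q').
by rewrite -[LHS]muniK Eq' ofuniM muniK.
Qed.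

(** The sequence [F], [s], [t] is triangular: [F] is monic in the last variable, [s] is free of it
    and monic in the preceding one, [t] is nonzero and free of both. *)
Lemma muni_monic_regular2 (k : fieldType) n (F : {mpoly k[n.+2]})
    (s : {mpoly k[n.+1]}) (t : {mpoly k[n]}) (x y q : {mpoly k[n.+2]}) :
  muni F \is monic -> muni s \is monic -> t != 0 ->
  mwiden (mwiden t) * x = mwiden s * y + q * F ->
  exists G q', x = mwiden s * G + q' * F.
Proof.
move=> monF mons t0 /(congr1 (@muni _ _)); rewrite muniD !muniM !muni_mwiden.
case/(monic_regular2 monF) => [a b|G [q' E]].
  rewrite [s * b]mulrC; case/(muni_monic_regular mons t0) => c ->.
  by exists c; rewrite mulrC.
exists (ofuni G), (ofuni q').
by rewrite -[LHS]muniK E ofuniD !ofuniM ofuniC muniK.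
Qed.

Section HomogDivision.
Variables (k : closedFieldType) (m da db e : nat) (I : finType).
Variables (F : {mpoly k[m.+3]}) (A B : I -> {mpoly k[m.+3]}).
Hypotheses (homF : F \is e.-homog) (homA : forall i, A i \is da.-homog).
Hypotheses (homB : forall i, B i \is db.-homog) (lt_db_e : (db < e)%N).
Hypothesis AB : forall i l, congr_mod F (A i * B l) (A l * B i).
Hypothesis nozero : forall c0 c1 c2 : k, (c0, c1, c2) != 0 ->
  F.@[@plane_point k m c0 c1 c2] = 0 -> exists i, (A i).@[@plane_point k m c0 c1 c2] != 0.

(** The ideal generated by [F] and the [A i]. *)
Definition span_mod X := exists c : I -> {mpoly k[m.+3]}, congr_mod F X (\sum_i c i * A i).

Lemma homog_span_mod : homog_ideal span_mod.
Proof.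
split; first split=> p q.
- move=> [c [u ->]] [c' [u' ->]]; exists (fun i => c i + c' i), (u + u').
  by under [in RHS]eq_bigr => i _ do rewrite mulrDl; rewrite big_split mulrDl /= addrACA.
- move=> [c [u ->]]; exists (fun i => p * c i), (p * u).
  by under [in RHS]eq_bigr => i _ do rewrite -mulrA; rewrite -big_distrr mulrDr /= mulrA.
move=> d p [c [u ->]].
have /choice[c' c'E] : forall i, exists r, pihomog mdeg d (c i * A i) = r * A i.
  by move=> i; have [r E _] := pihomog_mulr d (c i) (homA i); exists r.
have [u' u'E _] := pihomog_mulr d u homF.
exists c', u'; rewrite raddfD /= u'E raddf_sum /=; congr (_ + _).
by apply: eq_bigr => i _; apply: c'E.
Qed.

Lemma homog_division_monic : muni F \is monic -> F.@[@last_point _ k] != 0 ->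
  exists g G, G \is g.-homog /\ forall i, B i = G * A i.
Proof.
move=> monF F0.
have homJ := homog_span_mod; have [idJ _] := homJ.
have JF : span_mod F.
  exists (fun=> 0), 1; rewrite mul1r big1 ?add0r // => i _; exact: mul0r.
have JA i : span_mod (A i).
  exists (fun j => (j == i)%:R), 0; rewrite mul0r addr0 (bigD1 i) //= eqxx mul1r.
  by rewrite big1 ?addr0 // => j /negbTE ->; rewrite mul0r.
have [|d [s [t [homs s0 t0 Js Jt]]]] := homog_elimination2 homJ JF homF F0.
  move=> c0 c1 c2 c_neq0; case: (eqVneq F.@[@plane_point k m c0 c1 c2] 0) => [FP|FP].
    by have [i Ai] := nozero c_neq0 FP; exists (A i).
  by exists F.
have mons := muni_monic homs s0.
set s' := _ *: s in mons.
have [cs csE] : span_mod (mwiden s').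
  by rewrite /s' mwidenZ -mul_mpolyC; apply: (idealM idJ).
have [ct ctE] := Jt.
have s'0 : s' != 0.
  by apply: contraL mons => /eqP ->; rewrite muni0 monicE lead_coef0 eq_sym oner_eq0.
have [||G GE] := ratio_division AB csE ctE.
- by move=> x q; apply: muni_monic_regular.
- by move=> x y q; apply: muni_monic_regular2.
(* The component of degree [db] kills the multiple of [F], because [db < e]: the congruence becomes
   an equality. *)
have BE i : B i = pihomog mdeg db (G * A i).
  have [q qE] := GE i.
  by rewrite -[LHS](pihomog_dE (homB i)) qE raddfD /= (pihomogM_lt _ homF) ?addr0.
(* When [db < da] every [B i] is 0, and the quotient is 0. *)
case: (leqP da db) => [ab|ba].
  exists (db - da)%N, (pihomog mdeg (db - da) G); split; first exact: pihomogP.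
  by move=> i; rewrite BE -{1}(subnK ab) (pihomogM _ _ (homA i)).
exists 0%N, 0; split; first exact: rpred0.
by move=> i; rewrite BE mul0r (pihomogM_lt _ (homA i)).
Qed.
End HomogDivision.

Lemma homog_division (k : closedFieldType) m da db e (I : finType)
    (F : {mpoly k[m.+3]}) (A B : I -> {mpoly k[m.+3]}) :
  F \is e.-homog -> (forall i, A i \is da.-homog) -> (forall i, B i \is db.-homog) ->
  (db < e)%N -> (forall i l, congr_mod F (A i * B l) (A l * B i)) ->
  (forall c0 c1 c2 : k, (c0, c1, c2) != 0 ->
    F.@[@plane_point k m c0 c1 c2] = 0 -> exists i, (A i).@[@plane_point k m c0 c1 c2] != 0) ->
  F.@[@last_point _ k] != 0 ->
  exists g G, G \is g.-homog /\ forall i, B i = G * A i.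
Proof.
move=> homF homA homB lt_db_e AB nozero F0.
set c := F.@[_] in F0.
(* The value [c] of [F] at [last_point] is its leading coefficient in the last variable. *)
apply: (@homog_division_monic _ _ da db e _ (c^-1 *: F)) => //.
- exact: rpredZ.
- move=> i l; have [q ->] := AB i l; exists (c *: q).
  by rewrite -scalerAl -scalerAr scalerA mulfV // scale1r.
- move=> c0 c1 c2 c_neq0; rewrite mevalZ => /eqP.
  by rewrite mulf_eq0 invr_eq0 (negbTE F0) => /eqP; apply: nozero.
- exact: muni_monic homF F0.
by rewrite mevalZ mulf_neq0 ?invr_neq0.
Qed.

(** * Noetherianity and hyperplane sections *)

(** Each index is chosen where [u] reaches its minimum over the tail beyond the previous index. *)
Lemma nat_seq_nondecreasing_sub (u : nat -> nat) :
  exists phi : nat -> nat,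
    {homo phi : i j / (i < j)%N} /\ {homo u \o phi : i j / (i <= j)%N}.
Proof.
have min_tail N : exists i, (N <= i)%N /\ forall j, (i <= j)%N -> (u i <= u j)%N.
  have [m] := ubnP (u N); elim: m N => // m IHm N uN.
  have [minN|] := pselect (forall j, (N <= j)%N -> (u N <= u j)%N); first by exists N.
  move=> /existsNP[j /not_implyP[Nj /negP]]; rewrite -ltnNge => uj.
  have [|i [ji mini]] := IHm j; first exact: leq_trans uj uN.
  by exists i; split=> //; apply: leq_trans ji.
have /choice[g gP] := min_tail.
pose phi := fix phi n := if n is n'.+1 then g (phi n').+1 else g 0%N.
have phiS n : (phi n < phi n.+1)%N by have [] := gP (phi n).+1.
exists phi; split; first exact: homo_ltn ltn_trans phiS.
apply: (@homo_leq _ _ (fun i j => i <= j)%N leqnn (fun j i k => @leq_trans j i k)) => n /=.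
have mon : forall j, (phi n <= j)%N -> (u (phi n) <= u j)%N.
  by case: n => [|n]; [have [] := gP 0%N | have [] := gP (phi n).+1].
exact/mon/ltnW/phiS.
Qed.

(** Successive subsequences make the coordinates nondecreasing one after the other. *)
Lemma dickson n (f : nat -> 'X_{1..n}) : exists i j, (i < j)%N /\ (f i <= f j)%MM.
Proof.
suff [phi [incr mon]] : exists phi : nat -> nat, {homo phi : i j / (i < j)%N} /\
    forall l, l \in enum 'I_n -> {homo (fun i => f (phi i) l) : i j / (i <= j)%N}.
  exists (phi 0%N), (phi 1%N); split; first exact: incr.
  by apply/mnm_lepP => l; apply: mon; rewrite ?mem_enum.
elim: (enum 'I_n) => [|l s [phi [incr mon]]]; first by exists id; split=> [|l]; rewrite ?in_nil.
have [psi [incr' mon']] := nat_seq_nondecreasing_sub (fun i => f (phi i) l).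
exists (phi \o psi); split=> [i j ij|l']; first exact/incr/incr'.
rewrite inE => /orP[/eqP ->|/mon ml' i j ij]; first exact: mon'.
by apply: ml'; move: ij; rewrite leq_eqVlt => /orP[/eqP ->//|/incr'/ltnW].
Qed.

Lemma mleadB_lt (k : fieldType) n (p q : {mpoly k[n]}) :
  mlead p = mlead q -> mleadc p = mleadc q -> p - q != 0 ->
  (mlead (p - q) < mlead p)%O.
Proof.
move=> pq cpq pq0; rewrite lt_neqAle; apply/andP; split.
  apply: contra pq0 => /eqP E; rewrite -mleadc_eq0 E mcoeffB {2}pq -cpq.
  by rewrite subrr.
by rewrite (le_trans (mleadB_le _ _)) // -pq joinxx.
Qed.

(** If every inclusion were strict, take [f N] in [I N.+1] but not in [I N] with least leading
    monomial. By [dickson] the one of some [f i] divides that of a later [f j], and cancelling the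
    leading term of [f j] contradicts minimality. *)
Lemma mpoly_noetherian (k : fieldType) n (I : nat -> {mpoly k[n]} -> Prop) :
  (forall i, ideal (I i)) -> (forall i, I i 0) ->
  (forall i X, I i X -> I i.+1 X) ->
  exists N, forall X, I N.+1 X -> I N X.
Proof.
move=> idI I0 incrI; apply: contrapT => /forallNP strict.
have incrI' i j X : (i <= j)%N -> I i X -> I j X.
  by move/subnK <-; elim: (j - i)%N => // l IHl /IHl/incrI.
have /choice[f fP] : forall N, exists X, [/\ I N.+1 X, ~ I N X &
    forall Y, I N.+1 Y -> ~ I N Y -> (mlead X <= mlead Y)%O].
  move=> N; have [X /not_implyP[X1 X0]] := (existsNP _).2 (strict N).
  move: X X1 X0; apply: (@mleadrect _ _ (fun X => I N.+1 X -> ~ I N X -> _)) => X IH X1 X0.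
  have [//|noX] := pselect (forall Y, I N.+1 Y -> ~ I N Y -> (mlead X <= mlead Y)%O).
    by exists X.
  move/existsNP: noX => [Y /not_implyP[Y1 /not_implyP[Y0 /negP]]].
  by rewrite -ltNge => /IH; apply.
have [i [j [ij le_ij]]] := dickson (fun N => mlead (f N)).
have [fi1 fi0 _] := fP i; have [fj1 fj0 fjmin] := fP j.
have fi_neq0 : f i != 0 by apply: contra_notN fi0 => /eqP ->; apply: I0.
have fj_neq0 : f j != 0 by apply: contra_notN fj0 => /eqP ->; apply: I0.
pose c := mleadc (f j) / mleadc (f i).
pose q := c *: 'X_[mlead (f j) - mlead (f i)] * f i.
have Iq : I j q by apply: idealM => //; apply: incrI' ij fi1.
have fjq : f j - q != 0.
  by apply: contra_notN fj0; rewrite subr_eq0 => /eqP ->.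
have mq : mlead (f j) = mlead q /\ mleadc (f j) = mleadc q.
  have c0 : c != 0 by rewrite mulf_neq0 ?invr_eq0 ?mleadc_eq0.
  have X0 : 'X_[k, mlead (f j) - mlead (f i)] != 0 by rewrite -mleadc_eq0 mleadXm mcoeffX eqxx oner_neq0.
  have mE : mlead q = mlead (f j).
    by rewrite /q -scalerAl mleadZ // mleadM // mleadXm submK.
  split=> //; rewrite mE /q -scalerAl mcoeffZ mulrC.
  have := mcoeffMX (f i) (mlead (f j) - mlead (f i)) (mlead (f i)).
  by rewrite submK // [f i * _]mulrC => ->; rewrite mulrC divfK ?mleadc_eq0.
have [mq1 mq2] := mq.
have := mleadB_lt mq1 mq2 fjq; rewrite ltNge => /negP; apply; apply: fjmin.
  by apply: (idealD (idI _)) => //; rewrite -mulN1r; apply: (idealM (idI _)); apply: incrI.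
move=> Ifjq; apply: fj0; rewrite -(subrK q (f j)).
exact: (idealD (idI _)).
Qed.

(** * Components and linear sections of projective closed sets *)

Section ClosedSets.
Variables (k : closedFieldType) (n : nat).
Local Notation point := ('I_n.+1 -> k).
Local Open Scope classical_set_scope.
Implicit Types W Z C D : set point.

Lemma proj_closedI Z1 Z2 : proj_closed Z1 -> proj_closed Z2 -> proj_closed (Z1 `&` Z2).
Proof.
move=> [S1 homS1 ->] [S2 homS2 ->]; exists (S1 `|` S2).
  by move=> G [/homS1|/homS2].
apply/seteqP; split=> x.
  by move=> [[x0 x1] [_ x2]]; split=> // G [/x1|/x2].
by move=> [x0 x12]; split; split=> // G SG; apply: x12; [left|right].
Qed.

(** Noetherian induction: a counterexample starts a strictly decreasing sequence of closed sets,
    whose ideals of vanishing polynomials must become stationary. *)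
Lemma proj_closed_ind (P : set point -> Prop) :
  (forall W, proj_closed W ->
     (forall W', proj_closed W' -> W' `<=` W -> ~ W `<=` W' -> P W') -> P W) ->
  forall W, proj_closed W -> P W.
Proof.
move=> IH W0 clW0; apply: contrapT => nPW0.
pose bad W := proj_closed W /\ ~ P W.
have next (W : {W | bad W}) : exists W' : {W | bad W},
    projT1 W' `<=` projT1 W /\ ~ projT1 W `<=` projT1 W'.
  case: W => W [clW nPW] /=; apply: contrapT => /forallNP noW'.
  apply: nPW; apply: IH => // W' clW' W'W WW'; apply: contrapT => nPW'.
  by apply: (noW' (exist _ W' (conj clW' nPW'))).
have /choice[next_ nextP] := next.
pose W i := projT1 (iter i next_ (exist _ W0 (conj clW0 nPW0))).
have WS i : W i.+1 `<=` W i /\ ~ W i `<=` W i.+1 by apply: nextP.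
pose I i (G : {mpoly k[n.+1]}) := forall x, W i x -> G.@[x] = 0.
have [| | |N NP] := @mpoly_noetherian k _ I.
- move=> i; split=> p q; first by move=> p0 q0 x Wx; rewrite mevalD p0 // q0 // addr0.
  by move=> q0 x Wx; rewrite mevalM q0 // mulr0.
- by move=> i x _; rewrite meval0.
- by move=> i X XW x Wx; apply: XW; apply: (WS i).1.
(* The equations of [W N.+1] already vanish on [W N], which contradicts strictness. *)
apply: (WS N).2 => x Wx.
have [[S homS WE] _] : bad (W N.+1) by apply: (projT2 (iter N.+1 next_ _)).
rewrite WE; split=> [|G SG].
  have [[S' _ WE'] _] : bad (W N) by apply: (projT2 (iter N next_ _)).
  by move: Wx; rewrite WE' => -[].
by apply: NP Wx => y; rewrite WE => -[_]; apply.
Qed.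

Lemma point_row (x : point) : exists v : 'rV[k]_n.+1, x = v 0.
Proof. by exists (\row_i x i); apply: funext => i; rewrite mxE. Qed.

(* xs meets every irreducible component of W. The set C is irreducible but need
   not be closed, so that points are included. *)
Lemma irreducible_components W : proj_closed W ->
  exists2 xs : seq 'rV[k]_n.+1, (forall v, v \in xs -> W (v 0)) &
    forall C, C !=set0 ->
      (forall Z1 Z2, proj_closed Z1 -> proj_closed Z2 ->
        C `<=` Z1 `|` Z2 -> C `<=` Z1 \/ C `<=` Z2) ->
      C `<=` W ->
      exists2 D, proj_irreducible_closed D /\ (C `<=` D /\ D `<=` W) &
        exists2 v, v \in xs & D (v 0).
Proof.
move: W; apply: proj_closed_ind => W clW IH.
have [[x Wx]|W0] := pselect (W !=set0); last first.
  exists [::] => // C [x Cx] _ CW.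
  by case: W0; exists x; apply: CW.
(* An irreducible [W] is its only component, and any of its points will do. *)
have [irrW|] := pselect (forall Z1 Z2, proj_closed Z1 -> proj_closed Z2 ->
        W `<=` Z1 `|` Z2 -> W `<=` Z1 \/ W `<=` Z2).
  have [v xE] := point_row x.
  exists [:: v] => [w|C _ _ CW]; first by rewrite inE => /eqP ->; rewrite -xE.
  exists W; first by split; [split=> //; exists x|split].
  by exists v; rewrite ?mem_head // -xE.
(* Otherwise [W] is covered by two smaller closed sets, and an irreducible [C] lies in one of them;
   the two lists are concatenated. *)
move=> /existsNP[Z1 /existsNP[Z2 /not_implyP[cl1 /not_implyP[cl2]]]].
move=> /not_implyP[WZ /not_orP[WZ1 WZ2]].
have sub Z : proj_closed Z -> ~ W `<=` Z ->
    exists2 xs : seq 'rV[k]_n.+1, (forall v, v \in xs -> (W `&` Z) (v 0)) &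
    forall C, C !=set0 ->
      (forall Z1 Z2, proj_closed Z1 -> proj_closed Z2 ->
        C `<=` Z1 `|` Z2 -> C `<=` Z1 \/ C `<=` Z2) ->
      C `<=` W `&` Z ->
      exists2 D, proj_irreducible_closed D /\ (C `<=` D /\ D `<=` W `&` Z) &
        exists2 v, v \in xs & D (v 0).
  move=> clZ WnZ; apply: IH; first exact: proj_closedI.
  - exact: subIsetl.
  - by move=> WWZ; apply: WnZ => y /WWZ[].
have [xs1 xs1W h1] := sub _ cl1 WZ1.
have [xs2 xs2W h2] := sub _ cl2 WZ2.
exists (xs1 ++ xs2) => [v|C C0 irrC CW].
  by rewrite mem_cat => /orP[/xs1W|/xs2W] [].
have [CZ|CZ] := irrC _ _ cl1 cl2 (subset_trans CW WZ).
  have [|D [irrD [CD DW]] [v vxs Dv]] := h1 C C0 irrC; first by rewrite subsetI.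
  exists D; first by split=> //; split=> // y /DW[].
  by exists v; rewrite // mem_cat vxs.
have [|D [irrD [CD DW]] [v vxs Dv]] := h2 C C0 irrC; first by rewrite subsetI.
exists D; first by split=> //; split=> // y /DW[].
by exists v; rewrite // mem_cat vxs orbT.
Qed.

(** Given [c] good for the tail and [c'] nonzero on the head, both killing [z], the form
    [c + l *: c'] is good for all but finitely many [l]. *)
Lemma linear_form_avoiding (z : 'rV[k]_n.+1) (xs : seq 'rV[k]_n.+1) :
  (forall v, v \in xs -> ~~ (v <= z)%MS) ->
  exists2 c : 'cV[k]_n.+1, z *m c = 0 & forall v, v \in xs -> v *m c != 0.
Proof.
elim: xs => [|x xs IH] xsz; first by exists 0; rewrite ?mulmx0.
have [|c zc xsc] := IH; first by move=> v vxs; apply: xsz; rewrite inE vxs orbT.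
have [c' zc' xc'] : exists2 c' : 'cV[k]_n.+1, z *m c' = 0 & x *m c' != 0.
  have : x *m cokermx z != 0 by rewrite -submxE xsz ?mem_head.
  case/matrix0Pn => i [j ij]; exists (col j (cokermx z)).
    by rewrite colE mulmxA mulmx_coker mul0mx.
  by rewrite colE mulmxA -colE; apply/matrix0Pn; exists i, 0; rewrite mxE.
(* The value of [l] at which the form vanishes on [v]. If [v *m c' = 0] the division returns 0, but
   then no [l] makes the form vanish on [v]. *)
pose bad (v : 'rV[k]_n.+1) : k := - (v *m c) 0 0 / (v *m c') 0 0.
have [l lbad] := closed_field_avoid [seq bad v | v <- x :: xs].
exists (c + l *: c'); first by rewrite mulmxDr -scalemxAr zc zc' scaler0 addr0.
move=> v vxs; rewrite mulmxDr -scalemxAr; apply: contra lbad => /eqP E.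
have {}E : (v *m c) 0 0 + l * (v *m c') 0 0 = 0.
  by move/matrixP/(_ 0 0): E; rewrite !mxE.
have mx11_0 (A : 'M[k]_1) : A 0 0 = 0 -> A = 0.
  by move=> A0; rewrite [A]mx11_scalar A0 raddf0.
have vc' : (v *m c') 0 0 != 0.
  apply/eqP => vc'0; move: vxs E; rewrite vc'0 mulr0 addr0 inE.
  case/orP => [/eqP vx|/xsc vc] /mx11_0 vc0; last by rewrite vc0 eqxx in vc.
  by move/mx11_0: vc'0 => vc'0; rewrite -vx vc'0 eqxx in xc'.
apply/mapP; exists v => //.
by apply: (mulIf vc'); rewrite /bad divfK //; apply/eqP; rewrite -addr_eq0 addrC E.
Qed.

(** The last hypothesis says that [W] has dimension less than [r]. A hyperplane through [z] that
    avoids a chosen point on each component contains no component, so the section has dimension less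
    than [r - 1]; induction supplies the other columns of [H]. *)
Lemma cut_dimension r W (z : 'rV[k]_n.+1) :
  proj_closed W -> (forall v : 'rV_n.+1, W (v 0) -> ~~ (v <= z)%MS) ->
  (forall Cs : nat -> set point, ~ irreducible_chain W r Cs) ->
  exists2 H : 'M[k]_(n.+1, r), z *m H = 0 &
    forall v : 'rV_n.+1, W (v 0) -> v *m H != 0.
Proof.
elim: r W => [|r IHr] W clW Wz nochain.
  exists 0; first exact: mulmx0.
  (* For [r = 0] the set [W] is empty: a component containing the vector [v] would be a chain of
     length 0. *)
  move=> v Wv; have [xs _ /(_ [set v 0])[]] := irreducible_components clW.
  - by exists (v 0).
  - by move=> Z1 Z2 _ _ /(_ (v 0) erefl) [Z1v|Z2v]; [left|right] => _ ->.
  - by move=> _ ->.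
  move=> D [irrD [_ DW]] _; case: (nochain (fun=> D)).
  by split=> [i _|i]; rewrite ?ltn0.
have [xs xsW comps] := irreducible_components clW.
have [c zc xsc] := linear_form_avoiding (fun v vxs => Wz v (xsW v vxs)).
pose L : {mpoly k[n.+1]} := \sum_i c i 0 *: 'X_i.
have LE (v : 'rV_n.+1) : L.@[v 0] = (v *m c) 0 0.
  rewrite raddf_sum mxE; apply: eq_bigr => i _ /=.
  by rewrite mevalZ mevalXU mulrC.
have homL : L \is 1.-homog.
  by apply: rpred_sum => i _; rewrite rpredZ // dhomogX /= mdeg1.
have W_neq0 x : W x -> exists i, x i != 0 by case: clW => S _ -> [].
have clZ : proj_closed (proj_zeros [set L]) by exists [set L] => // G ->; exists 1%N.
have [||C chC|H zH HW] := IHr (W `&` proj_zeros [set L]).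
- exact: proj_closedI.
- by move=> v [Wv _]; apply: Wz.
- have [irrC Cmono] := chC.
  have [[_ Cr0 Crprime] CrW] := irrC r (leqnn r).
  have [|D [irrD [CD DW]] [v vxs Dv]] := comps (C r) Cr0 Crprime.
    exact: subset_trans CrW (@subIsetl _ _ _).
  (* A chain of length [r] in the section is extended by a component [D] of [W] containing [C r]. *)
  apply: (nochain (fun i => if (i <= r)%N then C i else D)); split=> i ir.
    case: ifP => [ir'|_]; last by split.
    by have [? CW] := irrC i ir'; split=> //; apply: subset_trans CW (@subIsetl _ _ _).
  have {ir} /orP[/eqP ->|ir] : (i == r) || (i < r)%N by rewrite -leq_eqVlt.
    (* The last inclusion is strict: [C r] lies on the hyperplane, while [D] has a point of [xs] off
       it. *)
    rewrite /= leqnn ltnn; split=> // DC.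
    have [_ [_ /(_ L erefl)]] := CrW _ (DC _ Dv).
    rewrite LE => vc0; have := xsc v vxs.
    by rewrite [_ *m _]mx11_scalar vc0 raddf0 eqxx.
  by rewrite /= (ltnW ir) ir; apply: Cmono.
have zcH : z *m row_mx c H = 0 by rewrite mul_mx_row zc zH row_mx0.
exists (row_mx c H); first exact: zcH.
move=> v Wv; apply/negP; change (~ v *m row_mx c H == 0).
rewrite mul_mx_row row_mx_eq0 => /andP[/eqP vc /eqP vH].
have := HW v; rewrite vH eqxx => vW.
suff /vW : (W `&` proj_zeros [set L]) (v 0) by [].
split=> //; split=> [|G ->]; first exact: W_neq0.
by rewrite LE vc mxE.
Qed.
End ClosedSets.

(** * Coordinates adapted to a plane *)

Section BasisExtension.
Variables (k : fieldType) (N : nat).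

Lemma rank_extend1 r l (A : 'M[k]_(r, N)) (K : 'M[k]_(l, N)) :
  (\rank A < \rank K)%N ->
  exists2 v : 'rV[k]_N, (v <= K)%MS & \rank (v + A)%MS = (\rank A).+1.
Proof.
move=> AK; have : ~~ (K <= A)%MS by apply: contraL AK => /mxrankS; rewrite -leqNgt.
case/row_subPn => i iA; exists (row i K); first exact: row_sub.
apply/eqP; rewrite eqn_leq; apply/andP; split.
  apply: leq_trans (mxrank_adds_leqif _ _) _.
  by rewrite -[X in (_ <= X)%N]add1n leq_add2r rank_leq_row.
rewrite rank_ltmx // ltmxE addsmxSr /=.
by apply: contra iA => /(submx_trans (addsmxSl _ _)).
Qed.

Lemma rank_extend q r (A : 'M[k]_(r, N)) :
  (q + \rank A <= N)%N ->
  exists D : 'M[k]_(q, N), \rank (D + A)%MS = (q + \rank A)%N.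
Proof.
elim: q => [_|q IHq qA].
  exists 0; apply: eqmx_rank.
  by rewrite addsmxSr addsmx_sub sub0mx submx_refl.
have [|D DE] := IHq; first exact: ltnW.
have [|v _ vE] := @rank_extend1 _ _ (D + A)%MS (1%:M : 'M_N); first by rewrite DE mxrank1.
have E : \rank (col_mx v D + A)%MS = \rank (v + (D + A))%MS.
  apply: eqmx_rank; rewrite addsmxA.
  by apply/eqmxP/adds_eqmx => //; apply/eqmx_sym/addsmxE.
by exists (col_mx v D); apply: etrans E _; rewrite vE DE.
Qed.
End BasisExtension.

(** Points are row vectors, so the indices [M j i] make the substitution the pullback along
    [y |-> y *m M]. *)
Definition linear_sub (k : fieldType) n (M : 'M[k]_n) : n.-tuple {mpoly k[n]} :=
  [tuple \sum_j M j i *: 'X_j | i < n].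

Section LinearSub.
Variables (k : fieldType) (n : nat).
Implicit Types (M : 'M[k]_n) (F : {mpoly k[n]}).

Lemma linear_sub_meval M F (y : 'rV_n) : (F \mPo linear_sub M).@[y 0] = F.@[(y *m M) 0].
Proof.
rewrite comp_mpoly_meval; apply: meval_eq => i; rewrite tnth_mktuple mxE raddf_sum /=.
by apply: eq_bigr => j _; rewrite mevalZ mevalXU mulrC.
Qed.

Lemma linear_sub_homog M F e : F \is e.-homog -> F \mPo linear_sub M \is e.-homog.
Proof.
apply: dhomog_comp_linear => i; rewrite tnth_mktuple rpred_sum // => j _.
by rewrite rpredZ // dhomogX /= mdeg1.
Qed.

Lemma linear_subK M F : M \in unitmx ->
  (F \mPo linear_sub M) \mPo linear_sub (invmx M) = F.
Proof.
move=> uM; elim/mpoly_ring_ind: F => [c|i|p q IHp IHq|p q IHp IHq].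
- by rewrite !comp_mpolyC.
- rewrite comp_mpolyXU -tnth_nth tnth_mktuple raddf_sum /=.
  under eq_bigr => j _ do rewrite comp_mpolyZ comp_mpolyXU -tnth_nth tnth_mktuple scaler_sumr.
  rewrite exchange_big /= (bigD1 i) //= [X in _ + X]big1 => [|l li].
    rewrite addr0; under eq_bigr => j _ do rewrite scalerA mulrC.
    rewrite -scaler_suml.
    have := mulVmx uM => /matrixP/(_ i i); rewrite !mxE eqxx => ->.
    by rewrite scale1r.
  under eq_bigr => j _ do rewrite scalerA mulrC.
  rewrite -scaler_suml.
  have := mulVmx uM => /matrixP/(_ l i); rewrite !mxE (negbTE li) => ->.
  by rewrite scale0r.
- by rewrite !raddfD /= IHp IHq.
by rewrite !rmorphM /= IHp IHq.
Qed.
End LinearSub.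

(** As [H] has [m] columns, its kernel has dimension at least 3. The vector [z] is completed by [p]
    and [q] inside the kernel, then by the rows of [D] to a basis; [z] is placed last. *)
Lemma adapted_coordinates (k : fieldType) m (z : 'rV[k]_m.+3) (H : 'M[k]_(m.+3, m)) :
  z != 0 -> z *m H = 0 ->
  exists M : 'M[k]_m.+3, [/\ M \in unitmx,
    \row_i (@last_point _ k i) *m M = z &
    forall c0 c1 c2, \row_i (@plane_point k m c0 c1 c2 i) *m M *m H = 0].
Proof.
move=> z0 zH; pose K := kermx H.
have rK : (3 <= \rank K)%N.
  rewrite mxrank_ker -(leq_add2r (\rank H)) subnK ?rank_leq_row //.
  by rewrite -[m.+3]/(3 + m)%N leq_add2l rank_leq_col.
have rz : \rank z = 1%N by rewrite rank_rV z0.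
have [|p pK rp] := @rank_extend1 _ _ _ _ z K; first by rewrite rz (leq_trans _ rK).
have [|q qK rq] := @rank_extend1 _ _ _ _ (p + z)%MS K; first by rewrite rp rz.
have [|D rD] := @rank_extend _ _ m _ (q + (p + z))%MS; first by rewrite rq rp rz addn3.
pose rows := extend_point (extend_point (extend_point (fun i => row i D) p) q) z.
pose M : 'M_m.+3 := \matrix_i rows i.
have mulM (y : 'I_m.+3 -> k) : \row_i y i *m M = \sum_i y i *: rows i.
  by rewrite mulmx_sum_row; apply: eq_bigr => i _; rewrite mxE rowK.
have planeE c0 c1 c2 : \row_i (@plane_point k m c0 c1 c2 i) *m M = c0 *: p + c1 *: q + c2 *: z.
  rewrite mulM !big_ord_recr /= /plane_point /rows !extend_point_max.
  rewrite !extend_point_widen !extend_point_max big1 ?add0r // => i _.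
  by rewrite !extend_point_widen scale0r.
exists M; split.
- rewrite -row_full_unit /row_full eqn_leq rank_leq_row /=.
  rewrite -[X in (X <= _)%N](_ : \rank (D + (q + (p + z)))%MS = m.+3); last first.
    by rewrite rD rq rp rz addn3.
  have rowsM i : (rows i <= M)%MS by rewrite -(rowK rows i); apply: row_sub.
  apply: mxrankS; rewrite !addsmx_sub; apply/and4P; split.
  + apply/row_subP => i; have := rowsM (widen_ord (leqnSn _) (widen_ord (leqnSn _) (widen_ord (leqnSn _) i))).
    by rewrite /rows !extend_point_widen.
  + have := rowsM (widen_ord (leqnSn _) ord_max).
    by rewrite /rows extend_point_widen extend_point_max.
  + have := rowsM (widen_ord (leqnSn _) (widen_ord (leqnSn _) ord_max)).
    by rewrite /rows !extend_point_widen extend_point_max.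
  by have := rowsM ord_max; rewrite /rows extend_point_max.
- have := planeE 0 0 1; rewrite /plane_point !extend_point0 => ->.
  by rewrite !scale0r scale1r !add0r.
move=> c0 c1 c2; rewrite planeE !mulmxDl -!scalemxAl zH.
by rewrite (sub_kermxP pK) (sub_kermxP qK) !scaler0 !addr0.
Qed.

Lemma division_on_hypersurface (k : closedFieldType) m da db e (I : finType)
    (F : {mpoly k[m.+3]}) (A B : I -> {mpoly k[m.+3]}) :
  F != 0 -> F \is e.-homog ->
  (forall i, A i \is da.-homog) -> (forall i, B i \is db.-homog) ->
  (db < e)%N -> (forall i l, congr_mod F (A i * B l) (A l * B i)) ->
  codim_ge 3 (proj_zeros [set F] `&` proj_zeros (range A))%classic ->
  exists g G, G \is g.-homog /\ forall i, B i = G * A i.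
Proof.
move=> F0 homF homA homB lt_db_e AB codim.
have [z Fz] := mpoly_nonvanishing F0.
pose W := (proj_zeros [set F] `&` proj_zeros (range A))%classic.
have clW : proj_closed W.
  apply: proj_closedI; first by exists [set F]%classic => // G ->; exists e.
  by exists (range A) => // G [i _ <-]; exists da.
(* In dimension [m.+2], codimension at least 3 excludes chains of length [m]. No point of [W] is
   proportional to [z], where [F] is nonzero. *)
have [||H zH HW] := @cut_dimension _ _ m W (\row_i z i) clW.
- move=> v [[[i vi] vF] _]; apply: contra vi => /sub_rVP[c vE].
  have /eqP : F.@[v 0] = 0 by apply: vF.
  rewrite vE; have -> : F.@[(c *: \row_i z i) 0] = c ^+ e * F.@[z].
    by rewrite -(dhomog_meval_scale _ _ homF); apply: meval_eq => j; rewrite !mxE.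
  by rewrite mulf_eq0 (negbTE Fz) orbF expf_eq0 => /andP[_ /eqP ->]; rewrite !mxE mul0r.
- by move=> C /codim; rewrite -[m.+2]/(2 + m)%N leq_add2r.
have z0 : \row_i z i != 0.
  apply: contra Fz => /eqP/rowP z0.
  rewrite (meval_eq (v2 := fun i => 0 * z i)) => [|i]; last by have := z0 i; rewrite !mxE mul0r.
  (* The degree [e] is positive because [db < e], so [F] vanishes at the origin. *)
  by rewrite (dhomog_meval_scale _ _ homF) expr0n gtn_eqF ?mul0r // (leq_trans _ lt_db_e).
have [M [uM Mz MH]] := adapted_coordinates z0 zH.
pose sub G := G \mPo linear_sub M.
have subE G (y : 'I_m.+3 -> k) : (sub G).@[y] = G.@[(\row_i y i *m M) 0].
  by rewrite -linear_sub_meval; apply: meval_eq => i; rewrite mxE.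
have [|||||||g [G [homG GE]]] := @homog_division _ _ da db e _ (sub F) (sub \o A) (sub \o B).
- exact: linear_sub_homog.
- by move=> i; apply: linear_sub_homog.
- by move=> i; apply: linear_sub_homog.
- exact: lt_db_e.
- move=> i l; have [q qE] := AB i l; exists (sub q).
  by rewrite /= /sub -!rmorphM qE rmorphD rmorphM.
(* A common zero on the plane would be a point of [W] killed by [H]. *)
- move=> c0 c1 c2 c_neq0; rewrite subE; set w := _ *m M => Fw.
  apply: contrapT => /forallNP Aw.
  have w0 : w != 0.
    apply: contra c_neq0 => /eqP w0.
    have /rowP P0 : \row_i @plane_point k m c0 c1 c2 i = 0.
      by rewrite -[LHS](mulmxK uM) -/w w0 mul0mx.
    have c0E := P0 (widen_ord (leqnSn _) (widen_ord (leqnSn _) ord_max)).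
    have c1E := P0 (widen_ord (leqnSn _) ord_max); have c2E := P0 ord_max.
    move: c0E c1E c2E; rewrite !mxE /plane_point !(extend_point_max, extend_point_widen).
    by move=> -> -> ->.
  have Ww : W (w 0).
    have w_neq0 : exists i, w 0 i != 0 by have /matrix0Pn[i [j]] := w0; rewrite ord1; exists j.
    split; split=> //; first by move=> _ ->.
    move=> _ [i _ <-]; have /negP := Aw i; rewrite negbK /= subE => /eqP; exact.
  by have := HW _ Ww; rewrite MH eqxx.
- by rewrite subE Mz (meval_eq (v2 := z)) // => i; rewrite mxE.
exists g, (G \mPo linear_sub (invmx M)); split; first exact: linear_sub_homog.
move=> i; rewrite -[LHS](linear_subK _ uM) -[A i in RHS](linear_subK _ uM) -rmorphM.
by congr comp_mpoly; apply: GE.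
Qed.

(** * Invariance and divisibility *)

Section VariablePrime.
Variables (k : fieldType) (n : nat) (j : 'I_n).
Implicit Types p q F H : {mpoly k[n]}.

Let kill p := p \mPo [tuple (if i == j then 0 else 'X_i : {mpoly k[n]}) | i < n].

Let killM p q : kill (p * q) = kill p * kill q. Proof. exact: rmorphM. Qed.

Let killX : kill 'X_j = 0.
Proof. by rewrite /kill comp_mpolyXU -tnth_nth tnth_mktuple eqxx. Qed.

Let killP p : exists q, p = kill p + 'X_j * q.
Proof.
elim/mpoly_ring_ind: p => [c|i|p q [p' pE] [q' qE]|p q [p' pE] [q' qE]].
- by exists 0; rewrite /kill comp_mpolyC mulr0 addr0.
- rewrite /kill comp_mpolyXU -tnth_nth tnth_mktuple; case: eqP => [->|_].
    by exists 1; rewrite add0r mulr1.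
  by exists 0; rewrite mulr0 addr0.
- by exists (p' + q'); rewrite /kill raddfD mulrDr /= addrACA -/(kill p) -/(kill q) -pE -qE.
exists (p' * q + kill p * q').
by rewrite killM {1}pE mulrDl {1}qE; ring.
Qed.

Lemma mpolyX_unitF : ('X_j : {mpoly k[n]}) \isn't a GRing.unit.
Proof.
apply/negP => /divrr/(congr1 (meval (fun=> 0)))/eqP.
by rewrite mevalM mevalXU mul0r meval1 eq_sym oner_eq0.
Qed.

Lemma mpolyX_neq0 : ('X_j : {mpoly k[n]}) != 0.
Proof. by rewrite -mleadc_eq0 mleadXm mcoeffX eqxx oner_neq0. Qed.

(** Setting the variable to 0 is a ring morphism to a domain; if [F] survives it, the powers of the
    variable can be cancelled one by one. *)
Lemma mpolyX_dvd_or F :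
  (exists q, F = 'X_j * q) \/
  (forall N H Q, 'X_j ^+ N * H = Q * F -> exists Q', H = Q' * F).
Proof.
have [q FE] := killP F; have [F0|F0] := eqVneq (kill F) 0.
  by left; exists q; rewrite FE F0 add0r.
right; elim=> [|N IHN] H Q E; first by exists Q; rewrite -E expr0 mul1r.
have [Q' QE] := killP Q.
have Q0 : kill Q = 0.
  have /eqP := congr1 kill E; rewrite exprS -mulrA !killM killX mul0r eq_sym.
  by rewrite mulf_eq0 (negbTE F0) orbF => /eqP.
apply: (IHN H Q'); apply: (mulfI mpolyX_neq0).
by rewrite mulrA -exprS E QE Q0 add0r mulrA.
Qed.
End VariablePrime.

Lemma mderivXU (R : nzRingType) n (i l : 'I_n) : ('X_l : {mpoly R[n]})^`M(i) = (l == i)%:R.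
Proof.
rewrite mderivX mnm1E; case: eqP => [->|_]; last by rewrite scale0r.
rewrite scale1r -mpolyX0; congr 'X_[_]; apply/mnmP => j.
by rewrite mnmBE subnn mnm0E.
Qed.

(** * Between homogeneous coordinates and affine charts *)

Section Rehomogenize.
Variables (k : fieldType) (n : nat) (j : 'I_n.+1).
Local Notation K := {fraction {mpoly k[n.+1]}}.
Local Notation fracC := (@FracField.tofrac {mpoly k[n.+1]} \o @mpolyC n.+1 k).

(** The rational function of degree 0 on projective space given by [P] on the chart. *)
Definition rehomog (P : {mpoly k[n]}) : K :=
  mmap fracC (fun i => ('X_(lift j i))%:F / ('X_j)%:F) P.

Lemma rehomogM P Q : rehomog (P * Q) = rehomog P * rehomog Q.
Proof. exact: rmorphM. Qed.

Lemma dehomogX_same : dehomog j ('X_j : {mpoly k[n.+1]}) = 1.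
Proof. by rewrite /dehomog comp_mpolyXU -tnth_nth tnth_mktuple unlift_none. Qed.

Lemma dehomogX_lift i : dehomog j ('X_(lift j i) : {mpoly k[n.+1]}) = 'X_i.
Proof. by rewrite /dehomog comp_mpolyXU -tnth_nth tnth_mktuple liftK. Qed.

Lemma dehomogC c : dehomog j (c%:MP : {mpoly k[n.+1]}) = c%:MP.
Proof. exact: comp_mpolyC. Qed.

Lemma dehomogD (P Q : {mpoly k[n.+1]}) : dehomog j (P + Q) = dehomog j P + dehomog j Q.
Proof. exact: raddfD. Qed.

Lemma dehomogB (P Q : {mpoly k[n.+1]}) : dehomog j (P - Q) = dehomog j P - dehomog j Q.
Proof. exact: raddfB. Qed.

Lemma dehomogM (P Q : {mpoly k[n.+1]}) : dehomog j (P * Q) = dehomog j P * dehomog j Q.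
Proof. exact: rmorphM. Qed.

Lemma fracX_neq0 : ('X_j : {mpoly k[n.+1]})%:F != 0.
Proof. by rewrite tofrac_eq0 mpolyX_neq0. Qed.

Lemma rehomogK h (H : {mpoly k[n.+1]}) :
  H \is h.-homog -> H%:F = ('X_j)%:F ^+ h * rehomog (dehomog j H).
Proof.
move=> homH.
have <- : mmap fracC (fun i => ('X_i)%:F) H = H%:F.
  elim/mpoly_ring_ind: H {homH} => [c|i|p q IHp IHq|p q IHp IHq].
  - by rewrite mmapC.
  - by rewrite mmapX mmap1U.
  - by rewrite mmapD IHp IHq rmorphD.
  by rewrite (rmorphM (mmap fracC _)) /= IHp IHq rmorphM.
rewrite (mmap_dhomog_scale (h := fun i => ('X_i)%:F / ('X_j)%:F) (c := ('X_j)%:F) _ homH); last first.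
  by move=> i; rewrite mulrC divfK ?fracX_neq0.
congr (_ * _); elim/mpoly_ring_ind: H {homH} => [c|i|p q IHp IHq|p q IHp IHq].
- by rewrite dehomogC /rehomog !mmapC.
- rewrite mmapX mmap1U; case: (unliftP j i) => [i' ->|->].
    by rewrite dehomogX_lift /rehomog mmapX mmap1U.
  by rewrite dehomogX_same /rehomog -mpolyC1 mmapC /= rmorph1 divff ?fracX_neq0.
- by rewrite dehomogD /rehomog !mmapD IHp IHq.
by rewrite dehomogM rehomogM (rmorphM (mmap fracC _)) /= IHp IHq.
Qed.

Lemma rehomog_clear (P : {mpoly k[n]}) : exists N Q, ('X_j)%:F ^+ N * rehomog P = Q%:F.
Proof.
elim/mpoly_ring_ind: P => [c|i|p q [N [P PE]] [M [Q QE]]|p q [N [P PE]] [M [Q QE]]].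
- by exists 0%N, c%:MP; rewrite /rehomog mmapC mul1r.
- exists 1%N, 'X_(lift j i); rewrite /rehomog mmapX mmap1U mulrC divfK ?fracX_neq0 //.
- exists (N + M)%N, ('X_j ^+ M * P + 'X_j ^+ N * Q).
  rewrite /rehomog mmapD -/(rehomog p) -/(rehomog q) rmorphD !rmorphM !rmorphXn /=.
  by rewrite -PE -QE exprD; ring.
exists (N + M)%N, (P * Q); rewrite rehomogM rmorphM /= -PE -QE exprD; ring.
Qed.

Lemma dehomog_neq0 h (H : {mpoly k[n.+1]}) :
  H \is h.-homog -> H != 0 -> dehomog j H != 0.
Proof.
move=> /rehomogK HE; apply: contra => /eqP H0.
by rewrite -tofrac_eq0 HE H0 /rehomog mmap0 mulr0.
Qed.

(** The chart does not see the hyperplane [x_j = 0], whence the power of ['X_j]. *)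
Lemma dehomog_dvd f h (F H : {mpoly k[n.+1]}) P :
  F \is f.-homog -> H \is h.-homog -> dehomog j H = P * dehomog j F ->
  exists N Q, 'X_j ^+ N * H = Q * F.
Proof.
move=> homF homH E; have [N [Q QE]] := rehomog_clear P.
exists (N + f)%N, ('X_j ^+ h * Q).
apply/eqP; rewrite -tofrac_eq; apply/eqP; rewrite !rmorphM !rmorphXn /=.
rewrite (rehomogK homH) E rehomogM [in RHS](rehomogK homF) -QE exprD; ring.
Qed.

Lemma mderiv_dehomog (i : 'I_n) (P : {mpoly k[n.+1]}) :
  (dehomog j P)^`M(i) = dehomog j P^`M(lift j i).
Proof.
elim/mpoly_ring_ind: P => [c|l|p q IHp IHq|p q IHp IHq].
- by rewrite dehomogC !mderivC /dehomog comp_mpoly0.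
- rewrite mderivXU; case: (unliftP j l) => [l' ->|->].
    rewrite dehomogX_lift mderivXU (inj_eq lift_inj).
    by case: eqP => _; rewrite /dehomog ?rmorph1 ?raddf0.
  rewrite dehomogX_same (negbTE (neq_lift _ _)) -mpolyC1 mderivC.
  by rewrite /dehomog raddf0.
- by rewrite dehomogD !mderivD dehomogD IHp IHq.
by rewrite dehomogM !mderivM dehomogD !dehomogM IHp IHq.
Qed.
End Rehomogenize.

Lemma dhomog_mderiv (R : nzRingType) n e i (F : {mpoly R[n]}) :
  F \is e.-homog -> F^`M(i) \is e.-1.-homog.
Proof.
move=> /dhomogP homF; apply/dhomogP => m; rewrite mcoeff_msupp mcoeff_deriv => Fm.
have /homF <- : (m + U_(i))%MM \in msupp F.
  by rewrite mcoeff_msupp; apply: contra Fm => /eqP ->; rewrite mul0rn.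
by rewrite /= mdegD mdeg1 addn1.
Qed.

Lemma frac_deriv_tofrac (k : fieldType) n i (P : {mpoly k[n]}) :
  frac_deriv i P%:F = (P^`M(i))%:F.
Proof.
have := frac_derivE i P (oner_neq0 {mpoly k[n]}).
by rewrite rmorph1 divr1 expr1n divr1 -mpolyC1 mderivC mulr0 subr0 mpolyC1 mulr1.
Qed.

Lemma regular_on1 (k : fieldType) n h : regular_on (1 : {mpoly k[n]}) h -> exists P, h = P%:F.
Proof. by move=> [P [m ->]]; exists P; rewrite rmorph1 expr1n divr1. Qed.

Lemma unit_on1 (k : fieldType) n : unit_on (1 : {mpoly k[n]}) 1.
Proof.
by split; rewrite ?invr1 ?oner_neq0 //; exists 1, 0%N; rewrite rmorph1 expr0 divr1.
Qed.

(** Invariance is read on the whole chart, with [g = 1], the generator [chart_form j A] and the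
    equation [dehomog j F]. *)
Lemma invariant_dehomog (k : fieldType) n (A : 'I_n.+1 -> {mpoly k[n.+1]})
    (F : {mpoly k[n.+1]}) e (j : 'I_n.+1) (i l : 'I_n) :
  invariant_by A F -> F \is e.-homog -> F != 0 ->
  exists P, dehomog j (A (lift j i) * F^`M(lift j l) - A (lift j l) * F^`M(lift j i))
    = P * dehomog j F.
Proof.
move=> inv homF F0; have f0 := dehomog_neq0 j homF F0.
have [||P PE] := regular_on1 (@inv j 1 (oner_neq0 _) (chart_form j A) (dehomog j F)%:F _ _ i l).
- by exists 1 => [|i']; rewrite ?mul1r //; apply: unit_on1.
- by exists 1; rewrite ?mul1r //; apply: unit_on1.
exists P; apply/eqP; rewrite -tofrac_eq [X in _ == X]rmorphM /= -PE divfK ?tofrac_eq0 //.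
rewrite !frac_deriv_tofrac !mderiv_dehomog /chart_form dehomogB !dehomogM.
by rewrite rmorphB !rmorphM.
Qed.

(** A chart with [j] distinct from [i] and [l] gives divisibility up to a power of ['X_j], which
    must then be cancelled. *)
Lemma invariant_dvd (k : fieldType) n d e (A : 'I_n.+1 -> {mpoly k[n.+1]})
    (F : {mpoly k[n.+1]}) :
  (2 <= n)%N -> invariant_by A F -> (forall i, A i \is d.-homog) -> F \is e.-homog ->
  F != 0 -> mpoly_squarefree F ->
  forall i l, exists Q, A i * F^`M(l) - A l * F^`M(i) = Q * F.
Proof.
move=> n2 inv homA homF F0 sqF i l.
have [j] : exists j, j \notin [set i; l].
  apply/existsP; apply: contraLR n2 => /existsPn allil.
  have : (#|'I_n.+1| <= #|[set i; l]|)%N.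
    rewrite -[X in (X <= _)%N]cardsT; apply: subset_leq_card; apply/fintype.subsetP => x _.
    by have := allil x; rewrite negbK.
  rewrite card_ord cards2 -ltnNge => /leq_trans; apply; by case: eqP.
rewrite !inE negb_or => /andP[ji jl].
have [i' iE] : exists i', i = lift j i' by case: (unliftP j i) ji => [i' ->|->]; [exists i'|rewrite eqxx].
have [l' lE] : exists l', l = lift j l' by case: (unliftP j l) jl => [l' ->|->]; [exists l'|rewrite eqxx].
have [P] := invariant_dehomog j i' l' inv homF F0; rewrite -iE -lE => PE.
have homH : A i * F^`M(l) - A l * F^`M(i) \is (d + e.-1).-homog.
  by apply: rpredB; apply: dhomogM => //; apply: dhomog_mderiv.
have [N [Q QE]] := dehomog_dvd homF homH PE.
have [[F' FE]|simplX] := mpolyX_dvd_or j F; last exact: simplX QE.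
(* If ['X_j] divides [F], square-freeness prevents it from dividing the cofactor [F'], modulo which
   it can be cancelled. *)
have [[F'' F'E]|simplX] := mpolyX_dvd_or j F'.
  have /negP := mpolyX_unitF k j; case; apply: (sqF _ F'').
  by rewrite FE F'E mulrA expr2.
(* Since [j] differs from [i] and [l], the factor ['X_j] comes out of both derivatives and restores
   [F] from [F'] at the end. *)
have derF r : j != r -> F^`M(r) = 'X_j * F'^`M(r).
  by move=> jr; rewrite FE mderivM mderivXU (negbTE jr) mul0r add0r.
have HE : A i * F^`M(l) - A l * F^`M(i) = 'X_j * (A i * F'^`M(l) - A l * F'^`M(i)).
  by rewrite !derF //; ring.
have [|Q' Q'E] := simplX N (A i * F^`M(l) - A l * F^`M(i)) (Q * 'X_j).
  by rewrite QE {1}FE mulrA.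
have [|Q'' Q''E] := simplX 1%N (A i * F'^`M(l) - A l * F'^`M(i)) Q'.
  by rewrite expr1 -HE Q'E.
by exists Q''; rewrite HE Q''E FE; ring.
Qed.

(** * Derivations of the function field *)

Record derivation (K : nzRingType) (D : K -> K) : Prop := Derivation {
  derivationD : forall a b, D (a + b) = D a + D b;
  derivationM : forall a b, D (a * b) = D a * b + a * D b
}.

Section DerivationPower.
Variables (K : comNzRingType) (D : K -> K).
Hypothesis derD : derivation D.

Lemma derivation0 : D 0 = 0.
Proof. by apply: (addIr (D 0)); rewrite -(derivationD derD) !add0r. Qed.

Lemma iter_derivation0 m : iter m D 0 = 0.
Proof. by elim: m => //= m ->; apply: derivation0. Qed.

Lemma iter_derivationD m a b : iter m D (a + b) = iter m D a + iter m D b.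
Proof. by elim: m => //= m ->; rewrite (derivationD derD). Qed.

Lemma derivation_sum I (r : seq I) (F : I -> K) : D (\sum_(i <- r) F i) = \sum_(i <- r) D (F i).
Proof. exact: (big_morph D (derivationD derD) derivation0). Qed.

Lemma derivationMn a m : D (a *+ m) = D a *+ m.
Proof.
elim: m => [|m IHm]; first by rewrite !mulr0n derivation0.
by rewrite !mulrS (derivationD derD) IHm.
Qed.

Lemma leibniz m a b :
  iter m D (a * b) = \sum_(i < m.+1) (iter (m - i) D a * iter i D b) *+ 'C(m, i).
Proof.
elim: m => [|m IHm]; first by rewrite big_ord1.
rewrite iterS IHm derivation_sum.
rewrite (eq_bigr (fun i : 'I_m.+1 => (iter (m - i).+1 D a * iter i D b) *+ 'C(m, i) +
   (iter (m - i) D a * iter i.+1 D b) *+ 'C(m, i))); last first.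
  by move=> i _; rewrite derivationMn (derivationM derD) mulrnDl.
rewrite big_split /= [X in X + _]big_ord_recl [X in _ + X]big_ord_recr /=.
rewrite [RHS]big_ord_recl [X in _ = _ + X]big_ord_recr /=.
rewrite !bin0 !binn !subn0 !subnn /= -!addrA; congr (_ + _).
rewrite addrA; congr (_ + _); rewrite -big_split /=; apply: eq_bigr => i _.
by rewrite /bump /= !add1n binS mulrnDr subSS add0n -(subnSK (ltn_ord i)) /=.
Qed.

(** In the Leibniz formula of order [p], all binomial coefficients but the two extreme ones are
    multiples of [p]. *)
Lemma derivation_pchar p : p \in [pchar K] -> derivation (iter p D).
Proof.
move=> pK; split=> a b; first exact: iter_derivationD.
have p_prime := pcharf_prime pK; have p0 := prime_gt0 p_prime.
rewrite leibniz; case: p pK p_prime p0 => // p pK p_prime _.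
rewrite big_ord_recl big_ord_recr /= big1 => [|i _]; last first.
  rewrite /bump add1n -mulr_natr.
  have /dvdnP[q ->] : (p.+1 %| 'C(p.+1, i.+1))%N by rewrite prime_dvd_bin ?ltnS ?ltn_ord.
  by rewrite natrM (pcharf0 pK) !mulr0.
by rewrite bin0 /bump /= add1n binn subnn add0r !mulr1n.
Qed.
End DerivationPower.

Section FractionDerivation.
Variables (k : fieldType) (n : nat).
Local Notation K := {fraction {mpoly k[n]}}.
Implicit Types (h : K) (v : 'I_n -> K).

Lemma frac_split h : exists P Q : {mpoly k[n]}, Q != 0 /\ h = P%:F / Q%:F.
Proof.
exists (\n_(repr h)), (\d_(repr h)); split; first exact: denom_ratioP.
exact: frac_repr.
Qed.

Lemma quotient_ruleD (L : fieldType) (P Q P' Q' dP dQ dP' dQ' : L) : Q != 0 -> Q' != 0 ->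
  ((dP * Q' + P * dQ' + (dP' * Q + P' * dQ)) * (Q * Q') -
    (P * Q' + P' * Q) * (dQ * Q' + Q * dQ')) / (Q * Q') ^+ 2 =
  (dP * Q - P * dQ) / Q ^+ 2 + (dP' * Q' - P' * dQ') / Q' ^+ 2.
Proof. by move=> Q0 Q'0; field; rewrite ?Q0 ?Q'0. Qed.

Lemma quotient_ruleM (L : fieldType) (P Q P' Q' dP dQ dP' dQ' : L) : Q != 0 -> Q' != 0 ->
  ((dP * P' + P * dP') * (Q * Q') - (P * P') * (dQ * Q' + Q * dQ')) / (Q * Q') ^+ 2 =
  (dP * Q - P * dQ) / Q ^+ 2 * (P' / Q') + P / Q * ((dP' * Q' - P' * dQ') / Q' ^+ 2).
Proof. by move=> Q0 Q'0; field; rewrite ?Q0 ?Q'0. Qed.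

Lemma frac_deriv_derivation i : derivation (@frac_deriv k n i).
Proof.
split=> a b; have [P [Q [Q0 ->]]] := frac_split a; have [P' [Q' [Q'0 ->]]] := frac_split b.
  rewrite addf_div ?tofrac_eq0 // -!tofracM -tofracD !frac_derivE ?mulf_neq0 //.
  rewrite !(mderivD, mderivM) !(tofracB, tofracD, tofracM).
  by apply: quotient_ruleD; rewrite tofrac_eq0.
rewrite mulf_div -!tofracM !frac_derivE ?mulf_neq0 //.
rewrite !mderivM !(tofracB, tofracD, tofracM).
by apply: quotient_ruleM; rewrite tofrac_eq0.
Qed.

Lemma vfield_derivation v : derivation (vfield_app v).
Proof.
split=> a b; rewrite /vfield_app.
  rewrite -big_split; apply: eq_bigr => i _.
  by rewrite (derivationD (frac_deriv_derivation i)) mulrDr.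
rewrite big_distrl big_distrr -big_split; apply: eq_bigr => i _ /=.
by rewrite (derivationM (frac_deriv_derivation i)); ring.
Qed.

Lemma vfield_tofrac v (P : {mpoly k[n]}) :
  vfield_app v P%:F = \sum_(i < n) v i * (P^`M(i))%:F.
Proof. by apply: eq_bigr => i _; rewrite frac_deriv_tofrac. Qed.

(** Agreement on polynomials follows from agreement on generators; differentiating [P = h * Q] then
    determines the value at [h]. *)
Lemma derivation_frac_ext (D E : K -> K) :
  derivation D -> derivation E ->
  (forall c, D (c%:MP)%:F = E (c%:MP)%:F) -> (forall i, D ('X_i)%:F = E ('X_i)%:F) ->
  D =1 E.
Proof.
move=> derD derE DEc DEx.
have DEp (P : {mpoly k[n]}) : D P%:F = E P%:F.
  elim/mpoly_ring_ind: P => // p q IHp IHq.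
    by rewrite rmorphD (derivationD derD) (derivationD derE) IHp IHq.
  by rewrite rmorphM (derivationM derD) (derivationM derE) IHp IHq.
move=> h; have [P [Q [Q0 hE]]] := frac_split h.
have QF0 : Q%:F != 0 by rewrite tofrac_eq0.
have hQ : P%:F = h * Q%:F by rewrite hE divfK.
apply: (mulIf QF0); apply: (addIr (h * D Q%:F)).
by rewrite -(derivationM derD) [in RHS]DEp -(derivationM derE) -hQ DEp.
Qed.

Section RegularOn.
Variable g : {mpoly k[n]}.
Hypothesis g0 : g != 0.
Let gF0 : g%:F != 0. Proof. by rewrite tofrac_eq0. Qed.

Lemma regular_on_tofrac (P : {mpoly k[n]}) : regular_on g P%:F.
Proof. by exists P, 0%N; rewrite expr0 divr1. Qed.

Lemma regular_onD a b : regular_on g a -> regular_on g b -> regular_on g (a + b).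
Proof.
move=> [P [m ->]] [Q [l ->]]; exists (P * g ^+ l + Q * g ^+ m), (m + l)%N.
by rewrite addf_div ?expf_neq0 // rmorphD !rmorphM !rmorphXn /= exprD.
Qed.

Lemma regular_onM a b : regular_on g a -> regular_on g b -> regular_on g (a * b).
Proof.
move=> [P [m ->]] [Q [l ->]]; exists (P * Q), (m + l)%N.
by rewrite mulf_div rmorphM /= exprD.
Qed.

Lemma regular_on_frac_deriv i a : regular_on g a -> regular_on g (frac_deriv i a).
Proof.
move=> [P [m ->]]; rewrite -rmorphXn frac_derivE ?expf_neq0 //.
by eexists; exists (m * 2)%N; rewrite rmorphXn -exprM.
Qed.

Lemma regular_on_vfield v a :
  (forall i, regular_on g (v i)) -> regular_on g a -> regular_on g (vfield_app v a).
Proof.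
move=> regv rega; rewrite /vfield_app; elim/big_ind: _ => [||i _].
- by rewrite -tofrac0; apply: regular_on_tofrac.
- exact: regular_onD.
by apply: regular_onM => //; apply: regular_on_frac_deriv.
Qed.
End RegularOn.
End FractionDerivation.

(** * Forms proportional to a differential *)

(** Vanishing derivatives force every exponent to be a multiple of [p]; coefficients have [p]-th
    roots in [k], and Frobenius is additive. *)
Lemma mpoly_pth_root (k : closedFieldType) n p (F : {mpoly k[n]}) :
  p \in [pchar k] -> (forall i, F^`M(i) = 0) -> exists G, F = G ^+ p.
Proof.
move=> pk dF0; have p_gt0 := prime_gt0 (pcharf_prime pk).
have pP : p \in [pchar {mpoly k[n]}] by rewrite pchar_lalg.
have /choice[r rE] : forall c : k, exists r, r ^+ p = c.
  move=> c; have /closed_rootP[r] : size ('X^p - c%:P : {poly k}) != 1%N.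
    by rewrite size_XnsubC // eqSS -lt0n.
  by rewrite /root !hornerE subr_eq0 => /eqP; exists r.
have dvd m i : m \in msupp F -> (p %| m i)%N.
  rewrite mcoeff_msupp => Fm; have [->|mi] := eqVneq (m i) 0%N; first exact: dvdn0.
  have /eqP := congr1 (mcoeff (m - U_(i))) (dF0 i).
  rewrite mcoeff_deriv mcoeff0 submK ?lep1mP // -mulr_natr mulf_eq0 (negbTE Fm) /=.
  by rewrite mnmBE mnm1E eqxx subn1 prednK ?lt0n // (dvdn_pcharf pk).
exists (\sum_(m <- msupp F) r F@_m *: 'X_[[multinom m i %/ p | i < n]]).
rewrite -(pFrobenius_autE pP) rmorph_sum /= [LHS]mpolyE big_seq [RHS]big_seq.
apply: eq_bigr => m mF; rewrite pFrobenius_autE exprZn rE mpolyXn.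
congr (_ *: 'X_[_]); apply/mnmP => i; rewrite mulmnE mnmE.
by rewrite divnK ?dvd.
Qed.

Lemma dhomog_unitF (k : fieldType) n e (F : {mpoly k[n]}) :
  (0 < e)%N -> F \is e.-homog -> F \isn't a GRing.unit.
Proof.
move=> e0 homF; apply/negP => /divrr/(congr1 (meval (fun=> 0)))/eqP.
rewrite mevalM (meval_eq (v2 := fun i => 0 * 0) F) => [|i]; last by rewrite mul0r.
rewrite (dhomog_meval_scale (fun=> 0) 0 homF) expr0n gtn_eqF // !mul0r meval1.
by rewrite eq_sym oner_eq0.
Qed.

Lemma squarefree_neq0 (k : fieldType) n (F : {mpoly k[n]}) : mpoly_squarefree F -> F != 0.
Proof.
move=> sqF; apply/eqP => F0; have := sqF 0 0; rewrite F0 mulr0 => /(_ erefl).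
by rewrite unitr0.
Qed.

(** Otherwise [F = G ^+ p] has the square factor [G ^+ 2], so [G] and [F] are units, against the
    positive degree. *)
Lemma squarefree_mderiv_neq0 (k : closedFieldType) n p e (F : {mpoly k[n]}) :
  p \in [pchar k] -> (0 < e)%N -> F \is e.-homog -> mpoly_squarefree F ->
  exists i, F^`M(i) != 0.
Proof.
move=> pk e0 homF sqF; apply: contrapT => /forallNP dF0.
have [|G FE] := mpoly_pth_root (F := F) pk.
  by move=> i; apply/eqP/negPn/negP => /dF0.
have p2 := prime_gt1 (pcharf_prime pk).
have /negP := dhomog_unitF e0 homF; apply; rewrite FE unitrX //.
by apply: (sqF _ (G ^+ (p - 2))); rewrite -exprD subnKC.
Qed.

Section MultipleOfDifferential.
Variables (k : closedFieldType) (n : nat).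
Variables (A : 'I_n.+1 -> {mpoly k[n.+1]}) (F G : {mpoly k[n.+1]}).
Hypotheses (G0 : G != 0) (FE : forall i, F^`M(i) = G * A i).

(** Differentiating [dF = G Omega] gives [G dOmega = - dG /\ Omega], hence [G Omega /\ dOmega = 0],
    and [G] cancels. *)
Lemma integrable_kernel : integrable A.
Proof.
move=> i l m /=.
have dA r s : G * ((A s)^`M(r) - (A r)^`M(s)) = A r * G^`M(s) - A s * G^`M(r).
  have := mderiv_comm s r F; rewrite !FE !mderivM => E.
  have -> : G * ((A s)^`M(r) - (A r)^`M(s)) =
    (G^`M(r) * A s + G * (A s)^`M(r)) - (G^`M(s) * A r + G * (A r)^`M(s))
    - (G^`M(r) * A s - G^`M(s) * A r) by ring.
  by rewrite E subrr; ring.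
apply: (mulfI G0); rewrite mulr0.
rewrite mulrDr mulrBr (mulrCA G (A i)) (mulrCA G (A l)) (mulrCA G (A m)) !dA.
ring.
Qed.

(** On a chart, a field is tangent exactly when it kills [dehomog j F]; its [p]-th iterate, a
    derivation in characteristic [p], then kills it too. *)
Lemma p_closed_kernel p g : p \in [pchar k] -> G \is g.-homog -> p_closed p A.
Proof.
move=> pk homG j q q0 v [regv vA].
have p_gt0 := prime_gt0 (pcharf_prime pk).
(* The coefficients of a vector field are its values on the coordinates. *)
pose w i := iter p (vfield_app v) ('X_i)%:F.
have pK : p \in [pchar {fraction {mpoly k[n]}}].
  rewrite inE (pcharf_prime pk) /= -(rmorph_nat (@FracField.tofrac {mpoly k[n]})).
  rewrite tofrac_eq0 -(rmorph_nat (@mpolyC n k)) mpolyC_eq0.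
  by case/andP: pk.
have der_v := vfield_derivation v.
have der_vp := derivation_pchar der_v pK.
have wE h : vfield_app w h = iter p (vfield_app v) h.
  move: h; apply: derivation_frac_ext => // [|c|i]; first exact: vfield_derivation.
    rewrite vfield_tofrac big1 => [|i _]; last by rewrite mderivC rmorph0 mulr0.
    rewrite -(prednK p_gt0) iterSr vfield_tofrac big1 ?iter_derivation0 //.
    by move=> i _; rewrite mderivC rmorph0 mulr0.
  rewrite vfield_tofrac (bigD1 i) //= mderivXU eqxx rmorph1 mulr1 big1 ?addr0 //.
  by move=> l li; rewrite mderivXU eq_sym (negbTE li) rmorph0 mulr0.
exists w => //; split=> [i|].
  rewrite /w; elim: (p) => [|m IHm]; first exact: regular_on_tofrac.
  exact: regular_on_vfield.
have gF0 : (dehomog j G)%:F != 0 by rewrite tofrac_eq0 (dehomog_neq0 _ homG).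
have dF u : vfield_app u (dehomog j F)%:F = (dehomog j G)%:F * \sum_(i < n) chart_form j A i * u i.
  rewrite vfield_tofrac big_distrr; apply: eq_bigr => i _ /=.
  by rewrite mderiv_dehomog FE dehomogM rmorphM /chart_form /=; ring.
apply: (mulfI gF0); rewrite mulr0 -dF wE -(prednK p_gt0) iterSr dF vA mulr0.
exact: iter_derivation0.
Qed.
End MultipleOfDifferential.

(** * Invariant hypersurfaces meeting the singular locus in codimension at least 3 *)

Theorem theorem1p4 (k : closedFieldType) (p n d e : nat)
    (A : 'I_n.+1 -> {mpoly k[n.+1]}) (F : {mpoly k[n.+1]}) :
  has_characteristic k p ->
  (2 <= n)%N ->
  codim1_distribution d A ->
  (0 < e)%N ->
  F \is e.-homog ->
  mpoly_squarefree F ->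
  invariant_by A F ->
  codim_ge 3 (hypersurface F `&` sing_locus A)%classic ->
  [/\ (0 < p)%N, (p %| e)%N & kernel_of_differential A F] /\
  integrable A /\ p_closed p A.
Proof.
move=> char_k n2 [homA eulerA _ _] e0 homF sqF inv codim.
have F0 := squarefree_neq0 sqF.
have [g [G [homG GE]]] : exists g G, G \is g.-homog /\ forall i, F^`M(i) = G * A i.
  case: n n2 A F homA eulerA homF sqF inv codim F0 => [//|[//|m]] n2 A F homA _ homF sqF inv codim F0.
  apply: (division_on_hypersurface (da := d.+1) (db := e.-1) (e := e) F0 homF homA) => //.
  - by move=> i; apply: dhomog_mderiv.
  - by rewrite prednK.
  move=> i l; have [Q QE] := invariant_dvd n2 inv homA homF F0 sqF i l.
  by exists Q; rewrite -QE addrC subrK.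
(* Euler's identity for [F], combined with [i_R Omega = 0]. *)
have ek : e%:R = 0 :> k.
  have := mpoly_euler homF.
  under eq_bigr => i _ do rewrite GE mulrCA.
  rewrite -big_distrr /= eulerA mulr0 => /esym/eqP.
  by rewrite -scaler_nat scaler_eq0 (negbTE F0) orbF => /eqP.
(* The positive integer [e] vanishes in [k], which excludes characteristic 0. *)
have [p' p'k] : exists p', p' \in [pchar k] by apply: natf0_pchar e0 _; apply/eqP.
have pk : p \in [pchar k].
  by move: char_k; rewrite /has_characteristic; case: eqP => // _ /(_ p'); rewrite p'k.
have [i0 Fi0] := squarefree_mderiv_neq0 pk e0 homF sqF.
have G0 : G != 0 by apply: contra Fi0 => /eqP G0; rewrite GE G0 mul0r.
split; last by split; [apply: integrable_kernel GE | apply: p_closed_kernel homG].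
split; first exact: prime_gt0 (pcharf_prime pk).
  by rewrite (dvdn_pcharf pk) ek.
by split=> [|i l]; [exists i0 | rewrite !GE; ring].
Qed.
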